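(* Let $2\le k\le n$ and $\mathbf{s}=(n-k+2,n-k+3,\dots,n)\in\mathbb{Z}_{>0}^{k-1}$. Then $\widetilde{E}^{\mathbf{s}}_{k-1}(x)=H_{U_{k,n}}(x)$. Consequently (using that every $\widetilde{E}^{\mathbf{s}}_m(x)$ is real-rooted), $H_{U_{k,n}}(x)$ has only real roots for every $1\le k\le n$.
   Context: For $\mathbf{s}=(s_1,\dots,s_m)\in\mathbb{Z}_{>0}^m$ let $\mathcal{I}^{\mathbf{s}}_m=\{\mathbf{e}=(e_1,\dots,e_m)\in\mathbb{Z}^m:0\le e_i<s_i\}$, with conventions $e_0=e_{m+1}=0$, $s_0=s_{m+1}=1$. An index $i\in\{0,\dots,m\}$ is an ascent of $\mathbf{e}$ if $e_i/s_i<e_{i+1}/s_{i+1}$ and a collision if $e_i/s_i=e_{i+1}/s_{i+1}$; $\mathrm{asc}(\mathbf{e})$, $\mathrm{col}(\mathbf{e})$ count them. Define $\widetilde{E}^{\mathbf{s}}_m(x)=\sum_{\mathbf{e}\in\mathcal{I}^{\mathbf{s}}_m}(1+x)^{\mathrm{col}(\mathbf{e})}x^{\mathrm{asc}(\mathbf{e})}$ (Haglund–Zhang have shown these are real-rooted). $U_{k,n}$ is the uniform matroid of rank $k$ on $[n]$. Augmented Chow ring: for a loopless matroid $M$ on $E$ with lattice of flats $\mathcal{L}(M)$, $\mathrm{CH}(M)=\mathbb{Q}[x_F,y_i: F\in\mathcal{L}(M)\setminus\{E\},\, i\in E]/(I'+J')$, $I'$ generated by $y_i-\sum_{F\not\ni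 i}x_F$, $J'$ by $x_{F_1}x_{F_2}$ for incomparable $F_1,F_2$ and $y_ix_F$ for $i\notin F$; variables of degree $1$; $H_M(x)=\sum_j\dim_{\mathbb{Q}}\mathrm{CH}^j(M)x^j$. *)

(* Defs.v *)
From HB Require Import structures.
From mathcomp Require Import all_boot all_order all_algebra.
From mathcomp Require Import reals.
From mathcomp Require Import multinomials.mpoly.
Set Implicit Arguments. Unset Strict Implicit. Unset Printing Implicit Defensive.
Import Order.TTheory GRing.Theory Num.Theory.
Local Open Scope ring_scope.

Definition urank (n k : nat) (A : {set 'I_n}) : nat := minn #|A| k.

Section AugChow.
Variables (n : nat) (r : {set 'I_n} -> nat).

Definition is_flat (F : {set 'I_n}) : bool :=
  [forall i, (i \notin F) ==> (r F < r (i |: F))%N].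

Definition proper_flat (F : {set 'I_n}) : bool := is_flat F && (F != setT).

Definition PFlat := {F : {set 'I_n} | proper_flat F}.

Definition Var := (PFlat + 'I_n)%type.
Definition nV := #|{: Var}|.
Definition Poly := {mpoly rat[nV]}.
Definition var (v : Var) : Poly := 'X_(enum_rank v).
Definition xF (F : PFlat) : Poly := var (inl F).
Definition yi (i : 'I_n) : Poly := var (inr i).

Definition incomparable (F1 F2 : PFlat) : bool :=
  ~~ (val F1 \subset val F2) && ~~ (val F2 \subset val F1).

Definition gensI : seq Poly :=
  [seq yi i - \sum_(F : PFlat | i \notin val F) xF F | i <- enum 'I_n].
Definition gensJ : seq Poly :=
  [seq xF p.1 * xF p.2 | p <- enum [pred p : PFlat * PFlat | incomparable p.1 p.2]]
  ++ [seq yi p.1 * xF p.2 | p <- enum [pred p : 'I_n * PFlat | p.1 \notin val p.2]].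
Definition gens : seq Poly := gensI ++ gensJ.

Definition inIdeal (p : Poly) : Prop :=
  exists c : seq Poly, p = \sum_(l < size gens) c`_l * gens`_l.

(* a family of d homogeneous polynomials of degree j whose images in
   CH(M) = Q[x,y]/(I'+J') are linearly independent over Q *)
Definition indep_family (j d : nat) (f : 'I_d -> Poly) : Prop :=
  (forall i, f i \is j.-homog) /\
  (forall a : 'I_d -> rat, inIdeal (\sum_(i < d) a i *: f i) -> forall i, a i = 0).

Definition isDimCH (j d : nat) : Prop :=
  (exists f : 'I_d -> Poly, indep_family j f) /\
  (forall d' : nat, (d < d')%N -> ~ exists f : 'I_d' -> Poly, indep_family j f).

End AugChow.

Section Etilde.
Variables (m : nat) (s : nat -> nat). (* s_1, ..., s_m are s 1, ..., s m *)

Definition Ebound : nat := (\max_(i < m) s i.+1)%N.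

(* e_i with e_0 = e_{m+1} = 0 *)
Definition ext (e : {ffun 'I_m -> 'I_Ebound}) (i : nat) : nat :=
  if i is j.+1 then
    match (insub j : option 'I_m) with Some j' => val (e j') | None => 0%N end
  else 0%N.
Definition sext (i : nat) : nat := if (0 < i <= m)%N then s i else 1%N.

Definition ratio (e : {ffun 'I_m -> 'I_Ebound}) (i : nat) : rat :=
  (ext e i)%:R / (sext i)%:R.

Definition asc (e : {ffun 'I_m -> 'I_Ebound}) : nat :=
  #|[set i : 'I_m.+1 | ratio e i < ratio e i.+1]|.
Definition col (e : {ffun 'I_m -> 'I_Ebound}) : nat :=
  #|[set i : 'I_m.+1 | ratio e i == ratio e i.+1]|.

Definition Etilde : {poly int} :=
  \sum_(e : {ffun 'I_m -> 'I_Ebound} | [forall i : 'I_m, (val (e i) < s (val i).+1)%N])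
     (1 + 'X) ^+ col e * 'X ^+ asc e.
End Etilde.

Definition realrooted (R : realType) (p : {poly R}) : Prop :=
  exists (c : R) (rs : seq R), p = c *: \prod_(x <- rs) ('X - x%:P).

(* Main.v *)
Require Import Defs.
From HB Require Import structures.
From mathcomp Require Import all_boot all_order all_algebra.
From mathcomp Require Import boolp reals ring_quotient.
From mathcomp Require Import multinomials.mpoly.
From mathcomp Require Import zify ring.

(** In CH(M) put h_S = sum of x_F over the proper flats F not containing S, so
that h_{i} = y_i.  Products of the h_S over chains of flats, with bounded
multiplicities ("nested" products), form a basis.  They span because every
relation between the h_S can be used to replace a product by products of larger
sets.  They are independent because each has a test element whose product with
it is the top class h_E^k, and with every other nested product of no smaller
total size is zero.  That h_E^k is nonzero is witnessed by the degree map
h_(S_1) .. h_(S_k) |-> 1 if (S_1, .., S_k) has a system of distinct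
representatives, 0 otherwise; it kills the ideal by the exchange property of
transversal matroids.

For s = (n-k+2, .., n) an ascent of e is an index with e_i < e_(i+1), and a
collision is a pair of consecutive zeros, so that E~ is computed by a transfer
recursion.  It has the same solution as the chain recursion counting nested
products, by an umbral computation. *)

Set Implicit Arguments. Unset Strict Implicit. Unset Printing Implicit Defensive.
Import Order.TTheory GRing.Theory Num.Theory.
Local Open Scope ring_scope.

(** The bounds on multiplicities come from one vanishing statement, [chain_vanish]. Its simplest
    form is x_T h_F^d = 0 when F is not inside T, d > 0 and d >= rk(T u F) - rk T. For G inside F it
    gives h_G h_F^d = h_F^(d+1) as soon as d > 0 and d >= rk F - rk G, which removes excessive
    multiplicities. Against a factor killing the flats incomparable to F, it also collapses x_G
    h_G^(rk G) h_F^(rk F - rk G - 1) to h_F^(rk F), so complementary exponents pair to the top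
    class. Spanning and independence thus meet at the same bound rk F - rk G - 1.

    The ideal is given by generators only, so a priori the quotient could even be zero. The degree
    map is therefore defined on a polynomial ring in free variables h_S, where it suffices to test
    monomials times generators.

    On the enumerative side, 1 - x has two origins: it clears the q-integers in the chain recursion,
    and it is the difference between the weights of a descending and an ascending step. This is why
    both sides satisfy one recursion. *)

Section Rank.
Variables (n k : nat).
Implicit Types S T F : {set 'I_n}.
Local Notation rk := (@urank n k).

Lemma urank_sub S T : S \subset T -> (rk S <= rk T)%N.
Proof. by move=> /subset_leq_card; rewrite /urank; lia. Qed.

Lemma urank_submod S T : (rk (S :|: T) + rk (S :&: T) <= rk S + rk T)%N.
Proof.
have := cardsUI S T; rewrite /urank.
have := subset_leq_card (subsetUl S T); have := subset_leq_card (subsetUr S T).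
have := subset_leq_card (subsetIl S T); have := subset_leq_card (subsetIr S T).
lia.
Qed.

Lemma urank_proper S T : (#|S| < k)%N -> S \proper T -> (rk S < rk T)%N.
Proof. by move=> ltSk /proper_card; rewrite /urank; lia. Qed.

Lemma urank_small S : (#|S| < k)%N -> rk S = #|S|.
Proof. by rewrite /urank; lia. Qed.

End Rank.

(** * Relations between the classes h_S *)

Definition incomp n (S T : {set 'I_n}) := ~~ (S \subset T) && ~~ (T \subset S).

Section ChowAlgebra.
Variables (n k : nat) (A : comNzRingType) (x : {set 'I_n} -> A).
Implicit Types (S T F G : {set 'I_n}) (L : seq {set 'I_n}).
Local Notation rk := (@urank n k).

Definition hsum S : A := \sum_(F : {set 'I_n} | ~~ (S \subset F)) x F.
Local Notation h := hsum.
Definition hprod L : A := \prod_(S <- L) h S.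
Definition cover_seq L : {set 'I_n} := \bigcup_(S <- L) S.

Hypothesis x_big : forall F, (k <= #|F|)%N -> x F = 0.
Hypothesis x_incomp : forall F G, incomp F G -> x F * x G = 0.
Hypothesis h_x : forall i F, i \notin F -> h [set i] * x F = 0.

Lemma cover_seq_cons S L : cover_seq (S :: L) = S :|: cover_seq L.
Proof. by rewrite /cover_seq big_cons. Qed.

Lemma hprod_cons S L : hprod (S :: L) = h S * hprod L.
Proof. by rewrite /hprod big_cons. Qed.

Lemma hprod_cat L1 L2 : hprod (L1 ++ L2) = hprod L1 * hprod L2.
Proof. by rewrite /hprod big_cat. Qed.

Lemma hprod_nseq a S : hprod (nseq a S) = h S ^+ a.
Proof. by rewrite /hprod big_nseq iter_mulr_1. Qed.

Lemma hprod_perm L1 L2 : perm_eq L1 L2 -> hprod L1 = hprod L2.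
Proof. by move=> eqL; apply: perm_big. Qed.

Lemma hprod_filter (P : pred {set 'I_n}) L :
  hprod L = hprod (filter P L) * hprod (filter (predC P) L).
Proof. by rewrite -hprod_cat; apply: hprod_perm; rewrite perm_sym perm_filterC. Qed.

Lemma hsum_big S : (k <= #|S|)%N -> h S = h setT.
Proof.
move=> kS; rewrite /hsum big_mkcond [RHS]big_mkcond /=; apply: eq_bigr => F _.
case: (ltnP #|F| k) => [ltFk|/x_big ->]; last by rewrite !if_same.
have nS (U : {set 'I_n}) : (k <= #|U|)%N -> ~~ (U \subset F); last first.
  by rewrite !nS // (leq_trans kS) //; apply/subset_leq_card/subsetT.
move=> kU; apply/negP => sUF; have := subset_leq_card sUF.
by move/(leq_trans kU); rewrite leqNgt ltFk.
Qed.

Lemma hsum_sub S T : S \subset T ->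
  h T = h S + \sum_(F : {set 'I_n} | (S \subset F) && ~~ (T \subset F)) x F.
Proof.
move=> sST; rewrite /hsum (bigID (fun F : {set 'I_n} => ~~ (S \subset F))) /=.
congr (_ + _); apply: eq_bigl => F; last by rewrite negbK andbC.
apply/andb_idl => nSF; apply: contra nSF; exact: subset_trans.
Qed.

Lemma cover_seq_sub L (P : {set 'I_n}) : all (fun S => S \subset P) L -> cover_seq L \subset P.
Proof.
elim: L => [|S L IH]; first by rewrite /cover_seq big_nil sub0set.
by rewrite cover_seq_cons /= subUset => /andP[-> /IH].
Qed.

Lemma cover_seq_filter (P : pred {set 'I_n}) L : cover_seq (filter P L) \subset cover_seq L.
Proof.
elim: L => [|S L IH] //=; case: ifP => _; rewrite !cover_seq_cons ?setUS //.
by apply: subset_trans IH (subsetUr _ _).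
Qed.

(* Expanding the first factor as [x F * h S = \sum_T x F * x T] over [T] strictly
   above [F], the other factors split into those with sets inside [T], to be
   combined with [x F], and the others, to be combined with [x T].
   Submodularity of the rank makes one of the two products vanish by induction. *)
Lemma chain_vanish F L : all (fun S => ~~ (S \subset F)) L -> (0 < size L)%N ->
  (rk (F :|: cover_seq L) <= rk F + size L)%N -> x F * hprod L = 0.
Proof.
have [m] := ubnP (size L); elim: m F L => // m IH F [//|S L] /ltnSE /= szL.
case: (leqP k #|F|) => [/x_big-> *|ltFk]; first by rewrite mul0r.
move=> /andP[nSF allL] _ leL; case/subsetPn: (nSF) => i iS iF.
rewrite hprod_cons mulrA (@hsum_sub [set i]); last by rewrite sub1set.
rewrite mulrDr [_ * h _]mulrC h_x // add0r mulr_sumr mulr_suml big1 // => T0; move: T0 => /= T.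
rewrite sub1set => /andP[iT nST].
case: (boolP (F \subset T)) => [sFT|nFT]; last first.
  rewrite x_incomp ?mul0r // /incomp nFT /=; apply/subsetPn; by exists i.
case: (leqP k #|T|) => [/x_big->|ltTk]; first by rewrite mulr0 mul0r.
rewrite (hprod_filter (fun S => S \subset T)).
set LA := filter _ L; set LB := filter _ L.
have szAB : (size LA + size LB = size L)%N by rewrite !size_filter count_predC.
set F' := F :|: cover_seq (S :: L) in leL.
have sAL : F :|: cover_seq LA \subset T :&: F'.
  rewrite subUset subsetI sFT subsetUl /= subsetI cover_seq_sub ?filter_all //=.
  apply: subset_trans (cover_seq_filter _ _) _.
  by rewrite /F' cover_seq_cons setUA subsetUr.
have sBL : T :|: cover_seq LB \subset T :|: F'.
  rewrite setUS //; apply: subset_trans (cover_seq_filter _ _) _.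
  by rewrite /F' cover_seq_cons setUA subsetUr.
have rA := urank_sub k sAL; have rB := urank_sub k sBL.
have smod : (rk (T :|: F') + rk (T :&: F') <= rk T + rk F')%N.
  exact: urank_submod.
have rF : (rk F < rk (T :&: F'))%N.
  apply: urank_proper => //; apply/properP; split.
    by rewrite subsetI sFT subsetUl.
  exists i => //; rewrite !inE iT /=; apply/orP; right; by rewrite cover_seq_cons inE iS.
have rT : (rk (T :&: F') < rk F')%N.
  apply: urank_proper.
    by apply: leq_ltn_trans ltTk; apply/subset_leq_card/subsetIl.
  rewrite properE subsetIr subsetI negb_and; apply/orP; left.
  apply: contra nST; apply: subset_trans.
  by rewrite /F' cover_seq_cons setUA subsetU // subsetUr.
have rS : (rk F' <= rk F + (size LA + size LB).+1)%N by rewrite szAB.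
have vA : (0 < size LA)%N -> (rk (F :|: cover_seq LA) <= rk F + size LA)%N ->
    x F * hprod LA = 0.
  apply: IH; last by rewrite all_filter; apply: sub_all allL => U /= ->; rewrite implybT.
  by apply: leq_ltn_trans szL; rewrite -szAB leq_addr.
have vB : (0 < size LB)%N -> (rk (T :|: cover_seq LB) <= rk T + size LB)%N ->
    x T * hprod LB = 0.
  apply: IH; last exact: filter_all.
  by apply: leq_ltn_trans szL; rewrite -szAB leq_addl.
have -> : x F * x T * (hprod LA * hprod LB) = (x F * hprod LA) * (x T * hprod LB).
  by ring.
case: (leqP (rk (F :|: cover_seq LA)) (rk F + size LA)%N) => cA; last first.
  have -> : x T * hprod LB = 0.
    by apply: vB; move: rA rB rF smod rT rS cA; clear; lia.
  by rewrite mulr0.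
(* With [LA] empty, [cA] carries no information and the first product is just [x F]; the strict
   inequality [rF] then supplies the unit needed for [vB]. *)
case: (posnP (size LA)) => sA; last first.
  have -> : x F * hprod LA = 0 by apply: vA; move: rA rB rF smod rT rS cA sA; clear; lia.
  by rewrite mul0r.
have -> : x T * hprod LB = 0 by apply: vB; move: rA rB rF smod rT rS cA sA; clear; lia.
by rewrite mulr0.
Qed.

(** A Hall-type obstruction. After expanding the first factor into the [x T], either the sets inside
    [T] already violate the Hall condition, or submodularity leaves so little rank for the others
    that [chain_vanish] kills them against [x T]. *)
Lemma hprod_vanish L : (rk (cover_seq L) < size L)%N -> hprod L = 0.
Proof.
have [m] := ubnP (size L); elim: m L => // m IH [//|S L] /ltnSE /= szL ltL.
rewrite hprod_cons [h S]/hsum mulr_suml big1 // => T nST.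
case: (leqP k #|T|) => [/x_big->|ltTk]; first by rewrite mul0r.
rewrite (hprod_filter (fun S => S \subset T)).
set LA := filter _ L; set LB := filter _ L.
have szAB : (size LA + size LB = size L)%N by rewrite !size_filter count_predC.
set F' := cover_seq (S :: L) in ltL.
have sAL : cover_seq LA \subset T :&: F'.
  rewrite subsetI cover_seq_sub ?filter_all //=.
  apply: subset_trans (cover_seq_filter _ _) _.
  by rewrite /F' cover_seq_cons subsetUr.
have sBL : T :|: cover_seq LB \subset T :|: F'.
  rewrite setUS //; apply: subset_trans (cover_seq_filter _ _) _.
  by rewrite /F' cover_seq_cons subsetUr.
have rA := urank_sub k sAL; have rB := urank_sub k sBL.
have smod : (rk (T :|: F') + rk (T :&: F') <= rk T + rk F')%N.
  exact: urank_submod.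
have rT : (rk (T :&: F') < rk F')%N.
  apply: urank_proper.
    by apply: leq_ltn_trans ltTk; apply/subset_leq_card/subsetIl.
  rewrite properE subsetIr subsetI negb_and; apply/orP; left.
  apply: contra nST; apply: subset_trans.
  by rewrite /F' cover_seq_cons subsetUl.
case: (ltnP (rk (cover_seq LA)) (size LA)) => cA.
  by rewrite (IH LA) ?mul0r ?mulr0 //; lia.
rewrite mulrCA (@chain_vanish T) ?mulr0 ?filter_all //; lia.
Qed.

(** Up to sign, each factor sums the [x F] over the [F] containing one of the two sets but not the
    other; flats taken from the two sums are incomparable. *)
Lemma hsum_incomp S T : (h S - h (S :|: T)) * (h T - h (S :|: T)) = 0.
Proof.
have dif (U V : {set 'I_n}) : U \subset V ->
    h U - h V = - \sum_(F : {set 'I_n} | (U \subset F) && ~~ (V \subset F)) x F.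
  by move=> sUV; rewrite (hsum_sub sUV) opprD addNKr.
rewrite !dif ?subsetUl ?subsetUr // mulrNN big_distrl big1 //= => F /andP[sSF nF].
rewrite big_distrr big1 //= => G /andP[sTG nG]; apply: x_incomp.
rewrite subUset sSF /= in nF; rewrite subUset sTG andbT in nG.
by apply/andP; split; [apply: contra nG|apply: contra nF]; apply: subset_trans.
Qed.

Lemma x_hexp T F d : ~~ (F \subset T) -> (0 < d)%N ->
  (rk (T :|: F) <= rk T + d)%N -> x T * h F ^+ d = 0.
Proof.
move=> nFT d0 le; rewrite -hprod_nseq chain_vanish ?size_nseq //.
- by rewrite all_nseq nFT orbT.
- suff -> : cover_seq (nseq d F) = F by [].
  by case: d d0 {le} => // d _; elim: d => [|d IH];
    rewrite /nseq -/(nseq _ _) cover_seq_cons ?IH ?setUid // /cover_seq big_nil setU0.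
Qed.

Lemma hsum_merge F G d : G \subset F -> (0 < d)%N -> (rk F <= rk G + d)%N ->
  h G * h F ^+ d = h F ^+ d.+1.
Proof.
move=> sGF d0 le; rewrite exprS [X in _ = X * _](hsum_sub sGF) mulrDl [X in _ + X]mulr_suml.
rewrite [X in _ + X]big1 ?addr0 // => T /andP[sGT nFT]; apply: x_hexp => //.
have := urank_submod k T F; have : (rk G <= rk (T :&: F))%N.
  by apply: urank_sub; rewrite subsetI sGT.
lia.
Qed.

Lemma hsum_mergeX F G a d : G \subset F -> (0 < d)%N -> (rk F <= rk G + d)%N ->
  h G ^+ a * h F ^+ d = h F ^+ (a + d).
Proof.
move=> sGF d0 le; elim: a => [|a IH]; first by rewrite mul1r.
by rewrite exprS -mulrA IH hsum_merge // ?addSn //; lia.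
Qed.

Lemma hsum_nilp F d : (rk F < d)%N -> h F ^+ d = 0.
Proof.
move=> lt; rewrite -hprod_nseq hprod_vanish // size_nseq.
apply: leq_ltn_trans lt; apply: urank_sub; apply: cover_seq_sub.
by rewrite all_nseq subxx orbT.
Qed.

(** By [hsum_mergeX] the right side contains h_G^(rk G) h_F^(rk F - rk G); one factor h_F is
    expanded as h_G + x_G + other terms. The first dies by [hsum_nilp], the [T] incomparable to [F]
    are killed by [z], and those strictly between [G] and [F] vanish against the remaining powers of
    h_F. In use, [z] is [x F] itself, or 1 when [F] is the full set. *)
Lemma x_merge z F G : (#|G| < k)%N -> G \proper F ->
  (forall T, incomp T F -> z * x T = 0) ->
  z * (x G * h G ^+ rk G * h F ^+ (rk F - rk G).-1) = z * h F ^+ rk F.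
Proof.
move=> ltGk pGF hz; have sGF := proper_sub pGF.
have ltr := urank_proper ltGk pGF.
have -> : rk F = (rk G + (rk F - rk G))%N by lia.
rewrite addKn -(hsum_mergeX _ sGF) //; try lia.
case dE: (rk F - rk G)%N => [|d]; first lia.
have -> : h F ^+ d.+1 = (h G + (x G + \sum_(T : {set 'I_n} |
    (G \subset T) && ~~ (F \subset T) && (T != G)) x T)) * h F ^+ d.
  rewrite exprS; congr (_ * _); rewrite (hsum_sub sGF) (bigD1 G) //=.
  by rewrite subxx /=; case/andP: pGF.
have -> a b c e f : z * (a * ((b + (c + e)) * f)) =
    z * (a * b * f) + z * (c * a * f) + z * (a * (e * f)) by ring.
rewrite -exprSr (@hsum_nilp G _ (ltnSn _)) mul0r mulr0 add0r.
rewrite [X in _ = _ + X](_ : _ = 0) ?addr0 //.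
rewrite mulr_suml !mulr_sumr big1 // => T /andP[/andP[sGT nFT] nTG].
case: (boolP (T \subset F)) => [sTF|nTF]; last first.
  have -> : z * (h G ^+ rk G * (x T * h F ^+ d)) = (z * x T) * (h G ^+ rk G * h F ^+ d).
    by ring.
  by rewrite hz ?mul0r // /incomp nTF nFT.
have ltGT : G \proper T by rewrite properEneq eq_sym nTG.
have rGT := urank_proper ltGk ltGT.
case: (leqP k #|T|) => [/x_big->|ltTk]; first by rewrite !(mul0r, mulr0).
have rTF : (rk T < rk F)%N by apply: urank_proper => //; rewrite properE sTF.
rewrite (x_hexp nFT) ?mulr0 //; first lia.
by rewrite (setUidPr sTF); lia.
Qed.

(** * Nested products and their test elements *)

(* A nested product is encoded by the list of its sets with multiplicities, by
   decreasing sets; the multiplicity of [S] is at most [chain_dim S s], where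
   [s] lists the smaller sets. *)
Definition chain_dim S (s : seq ({set 'I_n} * nat)) : nat :=
  if s is (S', _) :: _ then (rk S - rk S').-1 else rk S.

Fixpoint chain_below S (s : seq ({set 'I_n} * nat)) : bool :=
  if s is (S', a) :: s' then
    [&& S' \proper S, #|S'| < k, 0 < a <= chain_dim S' s' & chain_below S' s']%N
  else true.

Definition expand (s : seq ({set 'I_n} * nat)) := flatten [seq nseq p.2 p.1 | p <- s].
Definition weight L : nat := (\sum_(S <- L) #|S|)%N.

Lemma expand_cons S a s : expand ((S, a) :: s) = nseq a S ++ expand s.
Proof. by []. Qed.

Lemma weight_cat L1 L2 : weight (L1 ++ L2) = (weight L1 + weight L2)%N.
Proof. by rewrite /weight big_cat. Qed.

Lemma weight_cons S L : weight (S :: L) = (#|S| + weight L)%N.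
Proof. by rewrite /weight big_cons. Qed.

Lemma weight_perm L1 L2 : perm_eq L1 L2 -> weight L1 = weight L2.
Proof. by move=> eqL; apply: perm_big. Qed.

Lemma weight_nseq a S : weight (nseq a S) = (a * #|S|)%N.
Proof. by elim: a => [|a IH]; rewrite ?weight_cons ?IH // /weight big_nil. Qed.

Lemma weight_bound S L : all (fun T => T \subset S) L ->
  (weight L <= size L * #|S|)%N /\ (weight L = (size L * #|S|)%N -> L = nseq (size L) S).
Proof.
elim: L => [|T L IH]; first by rewrite /weight big_nil.
case/andP=> sTS /IH[le eqL]; rewrite weight_cons [size _]/= mulSn.
have leT := subset_leq_card sTS; split; first exact: leq_add.
move=> e; rewrite {1}eqL; last by move: le leT e; clear; lia.
by congr (_ :: _); apply/eqP; rewrite eqEcard sTS; move: le leT e; clear; lia.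
Qed.

Lemma chain_below_sub S s : chain_below S s -> all (fun T => T \proper S) (expand s).
Proof.
elim: s S => [//|[T a] s IH] S /= /and4P[pTS _ _ /IH].
rewrite expand_cons all_cat all_nseq pTS orbT /=.
by apply: sub_all => U /proper_trans; apply.
Qed.

(* [tester S a s] is dual to [h S ^+ a * hprod (expand s)]: the factors [x S']
   separate the contributions of the successive intervals of the chain. *)
Fixpoint tester S a (s : seq ({set 'I_n} * nat)) : A :=
  h S ^+ (chain_dim S s - a) * (if s is (S', a') :: s' then x S' * tester S' a' s' else 1).

(** Triangularity for the order by size, then by weight. The sets of [L] not inside [T] meet [x T]
    and a power of [h S], so [chain_vanish] allows at most [a] of them; those inside [T] meet the
    tester of [T]. Equal sizes force exactly [a] sets in the first group, and equal weights force
    all of these to be [S]. *)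
Lemma tester_vanish S a s L :
  chain_below S s -> (a <= chain_dim S s)%N -> all (fun T => T \subset S) L ->
  tester S a s * hprod L != 0 ->
  (size L <= size (nseq a S ++ expand s))%N /\
  (size L = size (nseq a S ++ expand s) ->
   (weight L <= weight (nseq a S ++ expand s))%N /\
   (weight L = weight (nseq a S ++ expand s) -> perm_eq L (nseq a S ++ expand s))).
Proof.
elim: s S a L => [|[T b] s IH] S a L.
  move=> _ lea allL /=; rewrite mulr1 cats0 size_nseq => nz.
  have leL : (size L <= a)%N.
    rewrite leqNgt; apply: contra_neqN nz => lt.
    rewrite -hprod_nseq -hprod_cat hprod_vanish // size_cat size_nseq.
    have : (rk (cover_seq (nseq (rk S - a) S ++ L)) <= rk S)%N.
      by apply/urank_sub/cover_seq_sub; rewrite all_cat all_nseq subxx orbT.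
    by move: lea lt; rewrite /chain_dim; lia.
  have [le eqL] := weight_bound allL.
  by split=> // sL; rewrite weight_nseq -sL; split=> // /eqL {1}->.
move=> /= /and4P[pTS ltTk /andP[b0 leb] gs] lea allL.
rewrite (hprod_filter (fun U : {set 'I_n} => U \subset T)).
have permL := permEl (perm_filterC (fun U : {set 'I_n} => U \subset T) L).
set LA := filter _ L in permL *; set LB := filter _ L in permL * => nz.
have sLB : all (fun U : {set 'I_n} => U \subset S) LB.
  by rewrite all_filter; apply: sub_all allL => U /= ->; rewrite implybT.
have leB : (size LB <= a)%N.
  rewrite leqNgt; apply: contra_neqN nz => lt.
  have -> : h S ^+ ((rk S - rk T).-1 - a) * (x T * tester T b s) * (hprod LA * hprod LB)
     = (x T * (h S ^+ ((rk S - rk T).-1 - a) * hprod LB)) * (tester T b s * hprod LA).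
    by ring.
  rewrite -hprod_nseq -hprod_cat chain_vanish ?mul0r //.
  - rewrite all_cat all_nseq filter_all andbT orbC.
    by case/andP: pTS => _ ->.
  - by rewrite size_cat; lia.
  - rewrite size_cat size_nseq.
    have : (rk (T :|: cover_seq (nseq ((rk S - rk T).-1 - a) S ++ LB)) <= rk S)%N.
      apply/urank_sub; rewrite subUset proper_sub // cover_seq_sub //.
      by rewrite all_cat all_nseq subxx orbT.
    by move: (urank_proper ltTk pTS) lea lt; lia.
have nzA : tester T b s * hprod LA != 0.
  apply: contra_neq nz => z.
  have -> : h S ^+ ((rk S - rk T).-1 - a) * (x T * tester T b s) * (hprod LA * hprod LB)
     = (x T * (h S ^+ ((rk S - rk T).-1 - a) * hprod LB)) * (tester T b s * hprod LA).
    by ring.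
  by rewrite z mulr0.
have := IH T b LA gs leb (filter_all _ _) nzA.
rewrite expand_cons; move: (nseq b T ++ expand s) => R.
rewrite -(perm_size permL) -(weight_perm permL) !size_cat !weight_cat size_nseq weight_nseq.
have [] := weight_bound sLB; move: leB.
have -> L' : perm_eq L L' = perm_eq (LB ++ LA) L'.
  by rewrite -(permPl permL) (permPl (permEl (perm_catC _ _))).
clearbody LA LB; clear.
move: (size LA) (size R) (weight LA) (weight R) (size LB) (weight LB) (erefl (size LB)).
move=> sA sR wA wR sB wB eB leB leWB eqWB [leA eqA].
split; first by move: leA leB; clear; lia.
move=> sEq; have eBa : sB = a by move: leA leB sEq; clear; lia.
have [|leWA eqWA] := eqA; first by move: eBa sEq; clear; lia.
rewrite eBa in leWB eqWB; split; first by move: leWA leWB; clear; lia.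
move=> wEq; rewrite eqWB; last by move: leWB leWA wEq; clear; nia.
by rewrite perm_cat2l eqWA //; move: leWB leWA wEq; clear; nia.
Qed.

(** The chain collapses from the bottom: induction with [z := x T] turns everything below [T] into
    h_T^(rk T), and [x_merge] absorbs that into a power of [h S]. *)
Lemma tester_diag S a s z : chain_below S s -> (a <= chain_dim S s)%N ->
  (forall T, incomp T S -> z * x T = 0) ->
  z * (tester S a s * hprod (nseq a S ++ expand s)) = z * h S ^+ rk S.
Proof.
elim: s S a z => [|[T b] s IH] S a z.
  by move=> _ lea hz; rewrite cats0 /= mulr1 hprod_nseq -exprD subnK.
move=> /= /and4P[pTS ltTk /andP[b0 leb] gs].
move=> lea hz.
rewrite expand_cons hprod_cat hprod_nseq.
have -> u v t w y : z * (u * (v * t) * (w * y)) = (z * (u * w)) * (v * (t * y)) by ring.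
rewrite -exprD subnK // IH //; last first.
  by move=> U nUT; rewrite mulrC x_incomp.
by rewrite -(x_merge ltTk pTS hz); ring.
Qed.

Lemma expand_inj S a1 s1 a2 s2 : chain_below S s1 -> chain_below S s2 ->
  perm_eq (nseq a1 S ++ expand s1) (nseq a2 S ++ expand s2) -> (a1, s1) = (a2, s2).
Proof.
have nin T s : chain_below T s -> count_mem T (expand s) = 0%N.
  move=> /chain_below_sub/allP al; apply/count_memPn/negP => /al.
  by rewrite properE subxx.
have hd T s : chain_below T s -> (expand s == [::]) = (s == [::]).
  by case: s => [//|[U [|c]] s] //=; rewrite !andbF.
have cnt T a s : chain_below T s -> count_mem T (nseq a T ++ expand s) = a.
  by move=> gs; rewrite count_cat count_nseq nin //= eqxx mul1n addn0.
elim: s1 S a1 a2 s2 => [|[T1 b1] s1 IH] S a1 a2 s2 g1 g2 pe;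
  have eqa : a1 = a2 by move/permP/(_ (pred1 S)): (pe); rewrite !cnt.
all: move: pe; rewrite {}eqa perm_cat2l => pe.
  congr pair; move: pe; rewrite perm_sym => /perm_nilP/eqP.
  by rewrite (hd S) // => /eqP.
case: s2 g2 pe => [|[T2 b2] s2] g2 pe.
  by move/perm_nilP/eqP: pe; rewrite (hd S).
have eqT : T1 = T2.
  have sub T U (b c : nat) s t : chain_below S ((T, b) :: s) -> chain_below S ((U, c) :: t) ->
      perm_eq (expand ((T, b) :: s)) (expand ((U, c) :: t)) -> T \subset U.
    move=> /= /and4P[_ _ /andP[b0 _] _] /and4P[_ _ _ /chain_below_sub/allP sub] /perm_mem/(_ T).
    rewrite !expand_cons !mem_cat !mem_nseq b0 eqxx /= => /esym/orP[/andP[_ /eqP->//]|].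
    by move/sub/proper_sub.
  apply/eqP; rewrite eqEsubset (sub _ _ _ _ _ _ g1 g2) //=.
  by apply: (sub _ _ _ _ _ _ g2 g1); rewrite perm_sym.
move: g1 g2 pe => /= /and4P[_ _ _ g1] /and4P[_ _ _ g2]; rewrite !expand_cons -eqT in g2 *.
by move/(IH _ _ _ _ g1 g2) => [-> ->].
Qed.

(** * Linear independence of the nested products *)

Hypothesis le_kn : (k <= n)%N.

Local Notation idx := (nat * seq ({set 'I_n} * nat))%type.

(* The multiplicity [f.1] of the full set may be zero, unlike those in [f.2]. *)
Definition nested_sets (f : idx) : seq {set 'I_n} := nseq f.1 setT ++ expand f.2.
Definition nested (f : idx) : bool :=
  chain_below setT f.2 && (f.1 <= chain_dim setT f.2)%N.

Variables (j : nat) (B : seq idx) (iota : {rmorphism rat -> A}).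
Hypothesis uniqB : uniq B.
Hypothesis memB : forall f : idx, (f \in B) = nested f && (size (nested_sets f) == j).

Lemma urankT : rk setT = k.
Proof. by rewrite /urank cardsT card_ord; apply/minn_idPr. Qed.

(** Induction on the weight of [f]. After multiplication by the tester of [f], lighter terms have
    coefficient zero by induction and all others except [f] vanish by [tester_vanish]; what remains
    is [c f] times the top power. *)
Lemma nested_indep (c : idx -> rat) : h setT ^+ k != 0 ->
  \sum_(f <- B) iota (c f) * hprod (nested_sets f) = 0 -> forall f, f \in B -> c f = 0.
Proof.
move=> top_nz sum0.
suff H m f : (weight (nested_sets f) < m)%N -> f \in B -> c f = 0.
  by move=> f; apply: H (ltnSn _).
elim: m f => // m IH f lt_m fB; apply: contraNeq top_nz => cf0.
move: (fB); rewrite memB => /andP[/andP[gf lef] /eqP szf].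
have: tester setT f.1 f.2 * (\sum_(g <- B) iota (c g) * hprod (nested_sets g)) = 0.
  by rewrite sum0 mulr0.
rewrite (bigD1_seq f) //= mulrDr [X in _ + X]mulr_sumr big1_seq ?addr0; last first.
  move=> g /andP[ngf gB]; move: (gB); rewrite memB => /andP[/andP[gg leg] /eqP szg].
  case: (eqVneq (tester setT f.1 f.2 * hprod (nested_sets g)) 0) => [z|nz].
    by rewrite mulrCA z mulr0.
  have [|_ H] := tester_vanish gf lef _ nz.
    by apply/allP => S _; apply: subsetT.
  have [leW eqW] := H (etrans szg (esym szf)).
  rewrite (IH g) ?rmorph0 ?mul0r ?mulr0 //.
  apply: leq_trans (_ : _ < weight (nested_sets f))%N _ => //; rewrite ltn_neqAle leW andbT.
  apply: contra ngf => /eqP/eqW/(expand_inj gg gf).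
  by case: (g) (f) => [? ?] [? ?] /= [-> ->].
rewrite mulrCA => /(congr1 (fun y => iota (c f)^-1 * y)).
rewrite /= mulr0 [X in X = _]mulrA -rmorphM mulVf // rmorph1 mul1r.
have td := tester_diag (z := 1) gf lef.
rewrite !mul1r urankT in td; rewrite td => [->//|T].
by rewrite /incomp subsetT.
Qed.

(** * The nested products span *)

Definition inspan (v : A) :=
  exists c : idx -> rat, v = \sum_(f <- B) iota (c f) * hprod (nested_sets f).

Lemma inspan0 : inspan 0.
Proof.
by exists (fun=> 0); rewrite big1 // => f _; rewrite rmorph0 mul0r.
Qed.

Lemma inspanD v w : inspan v -> inspan w -> inspan (v + w).
Proof.
move=> [c ->] [d ->]; exists (fun f => c f + d f).
by rewrite -big_split; apply: eq_bigr => f _; rewrite rmorphD mulrDl.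
Qed.

Lemma inspanZ a v : inspan v -> inspan (iota a * v).
Proof.
move=> [c ->]; exists (fun f => a * c f).
by rewrite mulr_sumr; apply: eq_bigr => f _; rewrite rmorphM mulrA.
Qed.

Lemma inspanN v : inspan v -> inspan (- v).
Proof. by move=> /(inspanZ (-1)); rewrite rmorphN rmorph1 mulN1r. Qed.

Lemma inspan_sum (I : Type) (r : seq I) (P : pred I) (F : I -> A) :
  (forall i, P i -> inspan (F i)) -> inspan (\sum_(i <- r | P i) F i).
Proof. by move=> H; apply: big_ind => //; [exact: inspan0 | exact: inspanD]. Qed.

Lemma inspan_nested f : nested f -> size (nested_sets f) = j -> inspan (hprod (nested_sets f)).
Proof.
move=> nf szf; have fB : f \in B by rewrite memB nf szf eqxx.
exists (fun g => (g == f)%:R); rewrite (bigD1_seq f) //= eqxx rmorph1 mul1r.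
by rewrite big1 ?addr0 // => g /negPf->; rewrite rmorph0 mul0r.
Qed.

Fixpoint weak_chain S (s : seq ({set 'I_n} * nat)) : bool :=
  if s is (S', a) :: s' then
    [&& S' \proper S, #|S'| < k, 0 < a & weak_chain S' s']%N
  else true.

Definition reducible L := hprod L = 0 \/
  exists L', [/\ size L' = size L, (weight L < weight L')%N & hprod L = hprod L'].

Lemma reducible_cat L1 L2 : reducible L2 -> reducible (L1 ++ L2).
Proof.
case=> [z|[L [sL wL eL]]]; first by left; rewrite hprod_cat z mulr0.
right; exists (L1 ++ L); rewrite !size_cat !weight_cat !hprod_cat sL eL.
by split=> //; rewrite ltn_add2l.
Qed.

(** A multiplicity above its bound at the bottom of the chain gives zero by [hsum_nilp]; higher up
    it is large enough for [hsum_merge] to replace one copy of the next set [T] by [S], which raises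
    the weight. *)
Lemma weak_chain_reduce S a s : weak_chain S s ->
  chain_below S s && (a <= chain_dim S s)%N \/ reducible (nseq a S ++ expand s).
Proof.
elim: s S a => [|[T b] s IH] S a.
  move=> _ /=; case: leqP => [|lt]; [by left | right; left].
  by rewrite cats0 hprod_nseq hsum_nilp.
move=> /= /and4P[pTS ltTk b0 /(IH T b)]; rewrite expand_cons.
case=> [/andP[gT leb]|]; last by right; apply: reducible_cat.
rewrite pTS ltTk b0 leb gT /=; case: leqP => [|lt]; [by left | right; right].
exists (nseq a.+1 S ++ nseq b.-1 T ++ expand s); split.
- by rewrite !size_cat !size_nseq; move: b0; clear; lia.
- rewrite !weight_cat !weight_nseq; move: (proper_card pTS) b0; clear.
  by case: b => // b; rewrite !mulSn /= => lt _; lia.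
- rewrite !hprod_cat !hprod_nseq -(prednK b0) exprS /=.
  rewrite -(@hsum_merge S T a) ?proper_sub //; first by ring.
    by move: lt; clear; lia.
  by move: (urank_proper ltTk pTS) lt; clear; lia.
Qed.

Lemma weak_chain_exists S L : all (fun T : {set 'I_n} => (T \proper S) && (#|T| < k)%N) L ->
  {in L &, forall T U : {set 'I_n}, (T \subset U) || (U \subset T)} ->
  exists2 s, weak_chain S s & perm_eq L (expand s).
Proof.
have [m] := ubnP (size L); elim: m S L => // m IH S L szL.
case: (eqVneq L [::]) => [-> _ _|nL allL cmp]; first by exists [::].
have [T TL maxT] : exists2 T, T \in L & forall U, U \in L -> (#|U| <= #|T|)%N.
  case: L nL {IH szL allL cmp} => // U0 L _.
  elim: L U0 => [|U1 L IH] U0; first (exists U0;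
    by [rewrite mem_head | move=> U; rewrite inE => /eqP->]).
  have [T TL maxT] := IH U1; case: (leqP #|U0| #|T|) => cTU.
    exists T; first by rewrite inE TL orbT.
    by move=> U; rewrite inE => /orP[/eqP->//|/maxT].
  exists U0; first exact: mem_head.
  move=> U; rewrite inE => /orP[/eqP->//|/maxT le]; exact: leq_trans le (ltnW cTU).
have sub U : U \in L -> U \subset T.
  move=> UL; have /orP[//|sTU] := cmp U T UL TL.
  by have /eqP-> : T == U by rewrite eqEcard sTU maxT.
have /andP[pTS ltTk] := allP allL T TL.
have permL := permEl (perm_filterC (pred1 T) L).
have eqn : filter (pred1 T) L = nseq (count_mem T L) T.
  rewrite -size_filter; apply/all_pred1P; exact: filter_all.
have c0 : (0 < count_mem T L)%N by rewrite -has_count has_pred1.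
have [||| s ws ps] := IH T (filter (predC (pred1 T)) L).
- move: szL; rewrite -(perm_size permL) size_cat eqn size_nseq; move: c0.
  by move: (size _) (count_mem T L); clear; lia.
- apply/allP => U; rewrite mem_filter /= => /andP[nUT UL].
  by rewrite properEneq nUT sub //=; case/andP: (allP allL U UL).
- by move=> U V; rewrite !mem_filter => /andP[_ UL] /andP[_ VL]; apply: cmp.
exists ((T, count_mem T L) :: s); first by rewrite /= pTS ltTk c0.
by rewrite expand_cons -(permPl permL) eqn perm_cat2l.
Qed.

Lemma weight_le L : (weight L <= size L * n)%N.
Proof.
have [|le _] := @weight_bound setT L; first by apply/allP => S _; apply: subsetT.
by rewrite cardsT card_ord in le.
Qed.

(** The weight is at most [j * n], so it suffices to raise it whenever the product is not nested. A
    set of size at least [k] becomes the full set, an incomparable pair is straightened by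
    [hsum_incomp], and a chain with excessive multiplicities is reduced. *)
Lemma inspan_hprod L : size L = j -> inspan (hprod L).
Proof.
have [m] := ubnP (j * n - weight L)%N; elim: m L => // m IH L ltm szL.
have up L' : size L' = j -> (weight L < weight L')%N -> inspan (hprod L').
  move=> sL' lt; apply: IH => //; have := weight_le L'; rewrite sL'.
  by move: ltm lt; clear; lia.
case: (boolP (all (fun S : {set 'I_n} => (#|S| < k)%N || (S == setT)) L))
    => [allL|]; last first.
  case/allPn=> S SL; rewrite negb_or -leqNgt => /andP[kS nST].
  have pL := perm_to_rem SL; rewrite (hprod_perm pL) hprod_cons.
  rewrite (hsum_big kS) -hprod_cons; apply: up.
    by rewrite -szL (perm_size pL).
  rewrite (weight_perm pL) !weight_cons ltn_add2r; apply: proper_card.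
  by rewrite properEneq nST subsetT.
case: (boolP (all (fun S : {set 'I_n} =>
    all (fun T : {set 'I_n} => (S \subset T) || (T \subset S)) L) L)) => [cmp|]; last first.
  case/allPn=> S SL /allPn[T TL]; rewrite negb_or => /andP[nST nTS].
  have pL := perm_to_rem SL.
  have TL' : T \in rem S L.
    move: TL; rewrite (perm_mem pL) inE => /orP[/eqP eTS|//].
    by move: nST; rewrite eTS subxx.
  have {pL} pL : perm_eq L [:: S, T & rem T (rem S L)].
    by apply: perm_trans pL _; rewrite perm_cons; apply: perm_to_rem.
  set R := rem T _ in pL; rewrite (hprod_perm pL) !hprod_cons.
  have e : h S * h T = h (S :|: T) * h S + h (S :|: T) * h T - h (S :|: T) * h (S :|: T).
    by apply/eqP; rewrite -subr_eq0 -(hsum_incomp S T); apply/eqP; ring.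
  have sR : size R = (j - 2)%N.
    by rewrite -szL (perm_size pL) /= subn2.
  have j2 : (1 < j)%N by rewrite -szL (perm_size pL).
  have ltS : (#|S| < #|S :|: T|)%N.
    by apply/proper_card/properP; split; [exact: subsetUl |];
      case/subsetPn: nTS => i iT iS; exists i; rewrite // inE iT orbT.
  have ltT : (#|T| < #|S :|: T|)%N.
    by apply/proper_card/properP; split; [exact: subsetUr |];
      case/subsetPn: nST => i iS iT; exists i; rewrite // inE iS.
  rewrite mulrA e mulrBl mulrDl -!mulrA -!hprod_cons.
  have spU (U : {set 'I_n}) : (#|S| + #|T| < #|S :|: T| + #|U|)%N ->
      inspan (hprod [:: S :|: T, U & R]).
    move=> lt; apply: up; first by rewrite /= sR; move: j2; clear; lia.
    by rewrite (weight_perm pL) !weight_cons !addnA ltn_add2r.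
  apply: inspanD; [apply: inspanD|apply: inspanN]; apply: spU.
  - by rewrite addnC ltn_add2r.
  - by rewrite ltn_add2r.
  - by apply: (@leq_trans (#|S :|: T| + #|T|)); rewrite ?ltn_add2r // leq_add2l ltnW.
have permL := permEl (perm_filterC (pred1 (setT : {set 'I_n})) L).
have eqn : filter (pred1 setT) L = nseq (count_mem setT L) (setT : {set 'I_n}).
  rewrite -size_filter; apply/all_pred1P; exact: filter_all.
have [|| s ws ps] := @weak_chain_exists setT (filter (predC (pred1 (setT : {set 'I_n}))) L).
- apply/allP => S; rewrite mem_filter /= => /andP[nT SL].
  rewrite properEneq nT subsetT /=.
  by have := allP allL S SL; rewrite (negPf nT) orbF.
- move=> S T; rewrite !mem_filter => /andP[_ SL] /andP[_ TL].
  exact: (allP (allP cmp S SL) T TL).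
have {ps} ps : perm_eq L (nseq (count_mem setT L) setT ++ expand s).
  by rewrite -(permPl permL) eqn perm_cat2l.
rewrite (hprod_perm ps); have szp := perm_size ps; rewrite szL in szp.
case: (weak_chain_reduce (count_mem setT L) ws) => [nf|].
  by apply: (@inspan_nested (count_mem setT L, s)).
case=> [->|[L' [sL' wL' ->]]]; first exact: inspan0.
by apply: up; rewrite ?sL' // (weight_perm ps).
Qed.

(** Downward induction on [F]: [h setT - h F] is the sum of [x F] and of the [x G] with [G] larger.
    This reduces degree one, hence every degree, to products of the h_S. *)
Lemma span_x F : exists c : {set 'I_n} -> rat, x F = \sum_S iota (c S) * h S.
Proof.
have [m] := ubnP (n - #|F|)%N; elim: m F => // m IH F ltm.
have {}IH G : F \proper G -> exists c : {set 'I_n} -> rat, x G = \sum_S iota (c S) * h S.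
  move=> /proper_card ltFG; apply: IH.
  have leG : (#|G| <= n)%N by rewrite -[X in (_ <= X)%N](card_ord n) max_card.
  by move: #|F| #|G| ltm ltFG leG; clear; lia.
pose lin v := exists c : {set 'I_n} -> rat, v = \sum_S iota (c S) * h S.
have linD v w : lin v -> lin w -> lin (v + w).
  move=> [c ->] [d ->]; exists (fun S => c S + d S).
  by rewrite -big_split; apply: eq_bigr => S _; rewrite rmorphD mulrDl.
have linN v : lin v -> lin (- v).
  move=> [c ->]; exists (fun S => - c S).
  by rewrite -sumrN; apply: eq_bigr => S _; rewrite rmorphN mulNr.
have linh T : lin (h T).
  exists (fun S => (S == T)%:R); rewrite (bigD1 T) //= eqxx rmorph1 mul1r.
  by rewrite big1 ?addr0 // => S /negPf->; rewrite rmorph0 mul0r.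
have lin0 : lin 0.
  by exists (fun=> 0); rewrite big1 // => S _; rewrite rmorph0 mul0r.
have lins (P : pred {set 'I_n}) : (forall G, P G -> F \proper G) -> lin (\sum_(G | P G) x G).
  by move=> sP; apply: big_ind => // G /sP/IH.
case: (eqVneq F setT) => [->|nFT].
  by case: (leqP k #|(setT : {set 'I_n})|) => [/x_big->//|];
    rewrite cardsT card_ord ltnNge le_kn.
have e := hsum_sub (subsetT F).
rewrite (bigD1 F) /= in e; last by rewrite subxx subTset.
have -> : x F = h setT - h F - \sum_(G : {set 'I_n} |
    (F \subset G) && ~~ (setT \subset G) && (G != F)) x G by rewrite e; ring.
apply: (linD _ _ (linD _ _ (linh _) (linN _ (linh _)))); apply: linN.
apply: lins => G.
by case/andP=> /andP[sFG _] nGF; rewrite properEneq eq_sym nGF.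
Qed.

End ChowAlgebra.

(** * Exchange in transversal matroids *)

Section Transversals.
Variable (I : finType).
Implicit Types (S T X Y Z : {set I}) (s : seq {set I}).

(* [sdr s X]: [X] is the set of values of a system of distinct representatives
   of [s], i.e. a basis of the transversal matroid of [s]. *)
Fixpoint sdr s X : bool :=
  if s is S0 :: s' then [exists a in S0 :&: X, sdr s' (X :\ a)] else X == set0.

Lemma sdr_consP S s X :
  reflect (exists a Y, [/\ a \in S, a \notin Y, X = a |: Y & sdr s Y]) (sdr (S :: s) X).
Proof.
apply: (iffP existsP) => /= [[a /andP[]]|[a [Y [aS aY -> sY]]]].
  rewrite inE => /andP[aS aX] sX; exists a, (X :\ a).
  by rewrite setD1K // !inE eqxx.
by exists a; rewrite !inE aS eqxx /= setU1K.
Qed.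

Lemma card_sdr s X : sdr s X -> #|X| = size s.
Proof.
elim: s X => [|S s IH] X; first by move/eqP->; rewrite cards0.
by case/sdr_consP=> a [Y [_ aY -> /IH]]; rewrite cardsU1 aY => ->.
Qed.

Lemma sdr_swap S T s X : sdr (S :: T :: s) X -> sdr (T :: S :: s) X.
Proof.
case/sdr_consP=> a [Y [aS aY -> /sdr_consP[b [Z [bT bZ eY sZ]]]]].
move: aY; rewrite {}eY !inE negb_or => /andP[nab aZ].
apply/sdr_consP; exists b, (a |: Z); split=> //.
- by rewrite !inE negb_or eq_sym nab.
- by rewrite setUCA.
- by apply/sdr_consP; exists a, Z.
Qed.

Lemma sdr_cons_eq S s t : sdr s =1 sdr t -> sdr (S :: s) =1 sdr (S :: t).
Proof. by move=> e X /=; apply: eq_existsb => a; rewrite e. Qed.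

Lemma sdr_move S s t : sdr (s ++ S :: t) =1 sdr (S :: s ++ t).
Proof.
elim: s => [//|T s IH] X; rewrite cat_cons (sdr_cons_eq _ IH).
by apply/idP/idP; apply: sdr_swap.
Qed.

Lemma sdr_perm s t : perm_eq s t -> sdr s =1 sdr t.
Proof.
elim: s t => [|S s IH] t; first by rewrite perm_sym => /perm_nilP->.
move=> pe; have St : S \in t by rewrite -(perm_mem pe) mem_head.
case/splitPr: St pe => t1 t2 pe X.
rewrite sdr_move; apply: sdr_cons_eq; apply: IH.
by move: pe; rewrite perm_sym -[S :: t2]cat1s perm_catCA perm_cons perm_sym.
Qed.

(** Basis exchange, by induction on the family: the representatives [a] and [c] of [S] are split
    off, the exchange is made within [s], and [S] takes [c] instead of [a] when necessary. *)
Lemma sdr_exchange s X Y b : sdr s X -> sdr s Y -> b \in X -> b \notin Y ->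
  exists p, [/\ p \in Y, p \notin X & sdr s (p |: (X :\ b))].
Proof.
elim: s X Y b => [|S s IH] X Y b; first by move/eqP->; rewrite inE.
move=> /sdr_consP[a [X' [aS aX' eX sX]]] /sdr_consP[c [Y' [cS cY' eY sY]]] bX bY.
have ncb : c != b by apply: contraNneq bY => <-; rewrite eY setU11.
(* Here [X :\ b] already represents [s], and [S] takes [c]. If [c] lies in [X], it is first
   exchanged within [s] for an element of [Y']. *)
have key : sdr s (X :\ b) ->
    exists p, [/\ p \in Y, p \notin X & sdr (S :: s) (p |: (X :\ b))].
  move=> sZ; case: (boolP (c \in X)) => cX; last first.
    exists c; rewrite eY setU11 cX; split=> //; apply/sdr_consP.
    by exists c, (X :\ b); rewrite !inE (negPf cX) andbF.
  have [|p [pY pZ sp]] := IH _ _ c sZ sY _ cY'; first by rewrite !inE ncb.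
  have pb : p != b by apply: contraNneq bY => <-; rewrite eY inE pY orbT.
  exists p; split; first by rewrite eY inE pY orbT.
    by move: pZ; rewrite !inE pb.
  apply/sdr_consP; exists c, (p |: ((X :\ b) :\ c)); split=> //.
    rewrite !inE eqxx /= orbF; apply: contraNneq cY' => ->; exact: pY.
  by rewrite setUCA setD1K // !inE ncb.
case: (eqVneq a b) => [eab|nab].
  by apply: key; rewrite eX -eab setU1K.
have bX' : b \in X' by move: bX; rewrite eX !inE eq_sym (negPf nab).
have bY' : b \notin Y' by apply: contra bY; rewrite eY inE orbC => ->.
have eXb : X :\ b = a |: (X' :\ b).
  by apply/setP => i; rewrite eX !inE; case: (eqVneq i a) => [->|_]; rewrite ?nab.
have [p [pY pX sp]] := IH _ _ b sX sY bX' bY'.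
(* If [p] is [a], then [s] has taken over the representative of [S], which is the situation of
   [key]. *)
case: (eqVneq p a) => [epa|npa]; first by apply: key; rewrite eXb -epa.
exists p; rewrite eY eX !inE pY orbT negb_or npa pX; split=> //.
apply/sdr_consP; exists a, (p |: X' :\ b); split=> //.
  by rewrite !inE negb_or eq_sym npa (negPf aX') andbF.
by rewrite -eX eXb setUCA.
Qed.

Definition avoidable s : {set I} := [set p | [exists X, sdr s X && (p \notin X)]].

Lemma avoidableP s p : reflect (exists2 X, sdr s X & p \notin X) (p \in avoidable s).
Proof.
rewrite inE; apply: (iffP existsP) => [[X /andP[sX pX]]|[X sX pX]]; exists X => //.
by rewrite sX.
Qed.

(* For distinct [p], [q]: [p] and [q] are independent in the dual of the
   transversal matroid of [s], whose non-loops are the elements of [avoidable s]. *)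
Definition avoid2 s p q := [exists X, [&& sdr s X, p \notin X & q \notin X]].

Lemma avoid2P s p q :
  reflect (exists X, [/\ sdr s X, p \notin X & q \notin X]) (avoid2 s p q).
Proof.
by apply: (iffP existsP) => [[X /and3P[? ? ?]]|[X [? ? ?]]]; exists X => //; apply/and3P.
Qed.

Lemma avoid2C s p q : avoid2 s p q = avoid2 s q p.
Proof. by apply: eq_existsb => X; rewrite andbA andbAC andbA. Qed.

Lemma avoid2_left s p q : avoid2 s p q -> p \in avoidable s.
Proof. by case/avoid2P=> X [sX pX _]; apply/avoidableP; exists X. Qed.

(** Transitivity of parallelism in the dual matroid: a non-loop [b] cannot be parallel to both of
    two independent elements. *)
Lemma avoid2_exchange s a b c : a != c -> avoid2 s a c -> b \in avoidable s ->
  avoid2 s a b || avoid2 s c b.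
Proof.
move=> nac /avoid2P[X [sX aX cX]] /avoidableP[Y sY bY].
case: (boolP (b \in X)) => bX; last first.
  by apply/orP; left; apply/avoid2P; exists X.
have [p [pY pX sp]] := sdr_exchange sX sY bX bY.
have npb : b != p by apply: contraNneq bY => ->.
case: (eqVneq a p) => [eap|nap]; apply/orP; [right|left]; apply/avoid2P;
  exists (p |: X :\ b); split; rewrite // !inE ?eqxx /= ?orbF //.
- by rewrite negb_or -{1}eap eq_sym nac (negPf cX) andbF.
- by rewrite negb_or nap (negPf aX) andbF.
Qed.

Lemma sdr_cons_exists S s : [exists X, sdr (S :: s) X] = (S :&: avoidable s != set0).
Proof.
apply/existsP/set0Pn => [[X /sdr_consP[a [Y [aS aY _ sY]]]]|[a]].
  by exists a; rewrite inE aS; apply/avoidableP; exists Y.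
rewrite inE => /andP[aS /avoidableP[Y sY aY]].
by exists (a |: Y); apply/sdr_consP; exists a, Y.
Qed.

Lemma avoidable_cons S s p :
  (p \in avoidable (S :: s)) = [exists t in S, (t != p) && avoid2 s t p].
Proof.
apply/avoidableP/existsP => [[X /sdr_consP[a [Y [aS aY -> sY]]]]|[t]].
  rewrite !inE negb_or => /andP[npa pY]; exists a; rewrite aS eq_sym npa.
  by apply/avoid2P; exists Y.
case/and3P=> tS ntp /avoid2P[X [sX tX pX]]; exists (t |: X).
  by apply/sdr_consP; exists t, X.
by rewrite !inE negb_or eq_sym ntp.
Qed.

Lemma avoidable_perm s t : perm_eq s t -> avoidable s = avoidable t.
Proof.
by move=> pe; apply/setP => p; rewrite !inE; apply: eq_existsb => X; rewrite (sdr_perm pe).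
Qed.

(** If [i] is not avoidable, it can never represent the new set, so adding it changes nothing. If it
    is, both sides are false: equality would make [j] independent in the dual from some [t] of the
    set, yet [i] parallel to both [j] and [t]. *)
Lemma avoidable_toggle s (F T : {set I}) i j : i \in F -> j \in T -> j \notin F ->
  (F == ~: avoidable ((i |: T) :: s)) = (F == ~: avoidable (T :: s)).
Proof.
move=> iF jT jF; have nij : i != j by apply: contraNneq jF => <-.
case: (boolP (i \in avoidable s)) => [iav|niav]; last first.
  congr (_ == ~: _); apply/setP => p; rewrite !avoidable_cons.
  apply/existsP/existsP => -[t /and3P[tT ntp Bt]]; exists t; rewrite ntp Bt ?andbT //.
    move: tT; rewrite !inE => /orP[/eqP eti|//].
    by rewrite -eti (avoid2_left Bt) in niav.
  by rewrite inE tT orbT.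
suff no T' : j \in T' -> (F == ~: avoidable (T' :: s)) = false.
  by rewrite !no // inE jT orbT.
move=> jT'; apply/negP => /eqP eF.
have : j \in avoidable (T' :: s) by move: jF; rewrite eF inE negbK.
rewrite avoidable_cons => /existsP[t /and3P[tT' ntj Btj]].
have : i \notin avoidable (T' :: s) by move: iF; rewrite eF inE.
rewrite avoidable_cons => /existsPn nB.
have nBj : ~~ avoid2 s j i by have := nB j; rewrite jT' eq_sym nij.
case/orP: (avoid2_exchange ntj Btj iav) => [Bti|Bji]; last by rewrite Bji in nBj.
case: (eqVneq t i) => [eti|nti]; first by rewrite -eti avoid2C Btj in nBj.
by have := nB t; rewrite tT' nti Bti.
Qed.

Lemma sdr_nseqT a X : sdr (nseq a setT) X = (#|X| == a).
Proof.
elim: a X => [|a IH] X; first by rewrite cards_eq0.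
apply/sdr_consP/idP => [[b [Y [_ bY -> ]]]|/eqP cX].
  by rewrite IH cardsU1 bY => /eqP->.
have /card_gt0P[b bX] : (0 < #|X|)%N by rewrite cX.
exists b, (X :\ b); rewrite setD1K // inE setD11 IH; split=> //.
by have := cardsD1 b X; rewrite bX cX add1n => -[->].
Qed.

End Transversals.

(** * Alternating sums over supersets *)

Section AltSums.
Variables (I : finType) (R : comNzRingType).
Implicit Types (F T P : {set I}).

Lemma altsum_toggle F i (f : {set I} -> R) : i \notin F ->
  (forall T, F \subset T -> i \notin T -> f (i |: T) = f T) ->
  \sum_(T : {set I} | F \subset T) (-1) ^+ #|T| * f T = 0.
Proof.
move=> iF inv; rewrite (bigID (fun T : {set I} => i \in T)) /=.
rewrite (reindex_onto (fun T => i |: T) (fun T => T :\ i)) /=; last first.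
  by move=> T /andP[_ iT]; rewrite setD1K.
rewrite (eq_bigl (fun T : {set I} => (F \subset T) && (i \notin T))); last first.
  move=> T; rewrite setU11 andbT; case: (boolP (i \in T)) => iT.
    rewrite andbF; apply/negP => /andP[_ /eqP/setP/(_ i)].
    by rewrite !inE eqxx iT.
  rewrite setU1K // eqxx !andbT; apply/idP/idP => sF; last first.
    by apply: subset_trans sF (subsetUr _ _).
  apply/subsetP => p pF; move/subsetP/(_ p pF): sF; rewrite !inE => /orP[/eqP epi|//].
  by rewrite -epi pF in iF.
rewrite -big_split big1 //= => T /andP[sFT iT].
by rewrite cardsU1 iT inv // exprS mulN1r mulNr addNr.
Qed.

(** An element outside [F] and [P] can be toggled. Without one, either [F] meets [P] and the
    indicator is constantly 1, or [F] is the complement of [P] and [T = F] is the only term missing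
    from a zero sum. *)
Lemma altsum_meet F P : F != setT ->
  \sum_(T : {set I} | F \subset T) (-1) ^+ #|T| * (T :&: P != set0)%:R
    = - (-1) ^+ #|F| * (F == ~: P)%:R :> R.
Proof.
move=> nFT.
case: (boolP (~: F \subset P)) => [sFP|/subsetPn[i]]; last first.
  rewrite inE => iF iP; rewrite (_ : (F == ~: P) = false) ?mulr0; last first.
    by apply/negP => /eqP eF; rewrite eF inE iP in iF.
  apply: (altsum_toggle iF) => T _ _; congr (_ != _)%:R.
  by apply/setP => p; rewrite !inE; case: eqVneq => // ->; rewrite (negPf iP) !andbF.
have [i iF] : exists i, i \notin F.
  by move: nFT; rewrite -subTset => /subsetPn[i _ iF]; exists i.
have all0 : \sum_(T : {set I} | F \subset T) (-1) ^+ #|T| * 1 = 0 :> R.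
  exact: (altsum_toggle iF).
case: (boolP (F == ~: P)) => [/eqP eF|nF]; last first.
  rewrite mulr0 -[RHS]all0; apply: eq_bigr => T sFT; congr (_ * _).
  have [p pF pP] : exists2 p, p \in F & p \in P.
    have : ~~ (F \subset ~: P).
      by apply: contra nF => sF; rewrite eqEsubset sF subCset.
    by case/subsetPn=> p pF; rewrite inE negbK; exists p.
  rewrite (_ : _ != _) //; apply/set0Pn; exists p.
  by rewrite inE pP (subsetP sFT).
move: all0; rewrite (bigD1 F) //= mulr1 => /eqP; rewrite addrC addr_eq0 => /eqP all0.
rewrite mulr1 -all0 (bigD1 F) //=.
have -> : F :&: P = set0 by rewrite eF setIC setICr.
rewrite eqxx mulr0 add0r.
apply: eq_bigr => T /andP[sFT nTF]; congr (_ * _).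
rewrite (_ : _ != _) //; apply: contra nTF; rewrite setI_eq0 disjoints_subset => sT.
by rewrite eqEsubset sFT eF sT.
Qed.

End AltSums.

(** * The degree map and the top class *)

Section Degree.
Variables (n k : nat).
Hypothesis k_gt0 : (0 < k)%N.
Hypothesis le_kn : (k <= n)%N.
Implicit Types (S T F G : {set 'I_n}).

Local Notation N := #|{set 'I_n}|.
Local Notation P := (Defs.Poly (@urank n k)).

Definition hvar S : {mpoly rat[N]} := 'X_(enum_rank S).

Definition mnm_sets (m : 'X_{1..N}) : seq {set 'I_n} :=
  flatten [seq nseq (m i) (enum_val i) | i <- enum 'I_N].

Lemma count_mnm_sets m S : count_mem S (mnm_sets m) = m (enum_rank S).
Proof.
rewrite /mnm_sets count_flatten -map_comp sumnE big_map big_enum /=.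
rewrite (bigD1 (enum_rank S)) //= count_nseq /= enum_rankK eqxx mul1n.
rewrite big1 ?addn0 // => i ni; rewrite count_nseq /=.
case: eqP => // eS; by rewrite -eS enum_valK eqxx in ni.
Qed.

Lemma size_mnm_sets m : size (mnm_sets m) = mdeg m.
Proof.
rewrite /mnm_sets size_flatten /shape -map_comp sumnE big_map big_enum /= mdegE.
by apply: eq_bigr => i _; rewrite size_nseq.
Qed.

Lemma mnm_sets_cons m S : perm_eq (mnm_sets (m + U_(enum_rank S))) (S :: mnm_sets m).
Proof.
apply/allP => T _; apply/eqP; rewrite /= !count_mnm_sets mnmDE mnm1E addnC.
by rewrite (inj_eq enum_rank_inj).
Qed.

(* The degree map, as a linear form on polynomials in variables [h_S]. *)
Definition deg (p : {mpoly rat[N]}) : rat :=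
  \sum_(m : 'X_{1..N < k.+1})
    p@_m * ((mdeg m == k) && [exists X, sdr (mnm_sets m) X])%:R.

Lemma deg_sum (J : Type) (r : seq J) (Q : pred J) (f : J -> {mpoly rat[N]}) :
  deg (\sum_(i <- r | Q i) f i) = \sum_(i <- r | Q i) deg (f i).
Proof.
rewrite /deg exchange_big /=; apply: eq_bigr => m _.
by rewrite raddf_sum mulr_suml.
Qed.

Lemma degZ a p : deg (a *: p) = a * deg p.
Proof. by rewrite /deg mulr_sumr; apply: eq_bigr => m _; rewrite mcoeffZ mulrA. Qed.

Lemma degB p q : deg (p - q) = deg p - deg q.
Proof. by rewrite /deg -sumrB; apply: eq_bigr => m _; rewrite mcoeffB mulrBl. Qed.

Lemma degX m : deg 'X_[m] = ((mdeg m == k) && [exists X, sdr (mnm_sets m) X])%:R.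
Proof.
rewrite /deg; case: (boolP (mdeg m == k)) => /= [/eqP mk|nmk]; last first.
  rewrite big1 // => m' _; rewrite mcoeffX.
  by case: eqP => [<-|_]; rewrite ?(negPf nmk) ?mul0r ?mulr0.
have lt : (mdeg m < k.+1)%N by rewrite mk.
rewrite (bigD1 (BMultinom lt)) //= mcoeffX eqxx mk eqxx mul1r big1 ?addr0 //.
move=> m' nm; rewrite mcoeffX; case: eqP => [e|_]; last by rewrite mul0r.
by case/eqP: nm; apply: val_inj; rewrite /= e.
Qed.

Lemma degXh m S :
  deg ('X_[m] * hvar S) = (((mdeg m).+1 == k) && (S :&: avoidable (mnm_sets m) != set0))%:R.
Proof.
rewrite -mpolyXD degX mdegD mdeg1 addn1 -sdr_cons_exists; congr (_ && _)%:R.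
by apply: eq_existsb => X; rewrite (sdr_perm (mnm_sets_cons _ _)).
Qed.

(* Moebius inversion of [h_S = - \sum_(F >= S) x_F], which holds for [h_0 = 0]. *)
Definition x_in_h F : {mpoly rat[N]} :=
  \sum_(T : {set 'I_n} | F \subset T) (- (-1) ^+ #|F| * (-1) ^+ #|T|) *: hvar T.

(** A monomial of degree k - 1 thus pairs with at most one [x_in_h F]: [F] must be the set of
    elements common to all its sets of representatives. *)
Lemma degXx m F : F != setT ->
  deg ('X_[m] * x_in_h F) = (((mdeg m).+1 == k) && (F == ~: avoidable (mnm_sets m)))%:R.
Proof.
move=> nFT; rewrite /x_in_h mulr_sumr deg_sum.
under eq_bigr => T _ do rewrite -scalerAr degZ degXh -mulrA.
rewrite -mulr_sumr; case: (_ == k) => /=; last first.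
  by rewrite big1 ?mulr0 // => T _; rewrite mulr0.
by rewrite altsum_meet // mulrA mulrNN -exprD addnn -mul2n exprM sqrrN !expr1n mul1r.
Qed.

Lemma deg_kill (g q : {mpoly rat[N]}) :
  (forall m, deg ('X_[m] * g) = 0) -> deg (q * g) = 0.
Proof.
move=> H; rewrite [q]mpolyE mulr_suml deg_sum big1 // => m _.
by rewrite -scalerAl degZ H mulr0.
Qed.

Lemma proper_flatE F : proper_flat (@urank n k) F = (#|F| < k)%N.
Proof.
apply/andP/idP => [[/forallP fl nF]|lt].
  have [i iF] : exists i, i \notin F.
    by move: nF; rewrite -subTset => /subsetPn[i _ iF]; exists i.
  have := fl i; rewrite iF /urank cardsU1 iF; lia.
split; last first.
  by apply: contraTneq lt => ->; rewrite cardsT card_ord -leqNgt.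
by apply/forallP => i; apply/implyP => iF; rewrite /urank cardsU1 iF; lia.
Qed.

Local Notation PF := (PFlat (@urank n k)).

Lemma PF_neqT (F : PF) : val F != setT.
Proof. by case: F => F /= /andP[]. Qed.

(** The complement of the avoidable set lies in any set of representatives, which has k - 1
    elements, so it is one of the proper flats. *)
Lemma sum_PF m (Q : pred {set 'I_n}) : (mdeg m).+1 = k -> Q (~: avoidable (mnm_sets m)) ->
  avoidable (mnm_sets m) != set0 ->
  \sum_(F : PF | Q (val F)) ((val F == ~: avoidable (mnm_sets m)))%:R = 1 :> rat.
Proof.
move=> mk QF /set0Pn[p /avoidableP[X sX pX]].
have pf : proper_flat (@urank n k) (~: avoidable (mnm_sets m)).
  rewrite proper_flatE -mk ltnS -size_mnm_sets -(card_sdr sX).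
  apply/subset_leq_card; rewrite subCset; apply/subsetP => i.
  by rewrite inE => iX; apply/avoidableP; exists X.
rewrite (bigD1 (Sub _ pf : PF)) ?SubK //= eqxx big1 ?addr0 // => F /andP[_ nF].
case: eqP => // eF; case/eqP: nF; apply: val_inj; by rewrite SubK.
Qed.

Definition var_in_h (v : Var (@urank n k)) : {mpoly rat[N]} :=
  match v with inl F => x_in_h (val F) | inr i => hvar [set i] end.

Definition to_h : P -> {mpoly rat[N]} :=
  comp_mpoly [tuple var_in_h (enum_val i) | i < nV (@urank n k)].

HB.instance Definition _ := GRing.LRMorphism.copy to_h
  (comp_mpoly [tuple var_in_h (enum_val i) | i < nV (@urank n k)]).

Lemma to_h_var v : to_h (var v) = var_in_h v.
Proof.
by rewrite /to_h comp_mpolyXU -tnth_nth tnth_mktuple enum_rankK.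
Qed.

Lemma to_h_xF (F : PF) : to_h (xF F) = x_in_h (val F). Proof. exact: to_h_var. Qed.
Lemma to_h_yi i : to_h (yi _ i) = hvar [set i]. Proof. exact: to_h_var. Qed.

Lemma deg_gensI m i :
  deg ('X_[m] * to_h (yi _ i - \sum_(F : PF | i \notin val F) xF F)) = 0.
Proof.
rewrite rmorphB rmorph_sum /= to_h_yi mulrBr degB degXh mulr_sumr deg_sum.
under eq_bigr => F _ do rewrite to_h_xF (degXx _ (PF_neqT F)).
case: eqP => [mk|] /=; last by rewrite big1 ?subrr.
case: (boolP (i \in avoidable (mnm_sets m))) => iav.
  have iP : i \in [set i] :&: avoidable (mnm_sets m) by rewrite in_setI set11.
  have av0 : avoidable (mnm_sets m) != set0 by apply/set0Pn; exists i.
  rewrite (@sum_PF _ (fun F : {set 'I_n} => i \notin F) mk) ?in_setC ?iav //.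
  by rewrite (_ : _ != _) ?subrr //; apply/set0Pn; exists i.
rewrite (_ : _ :&: _ = set0); last first.
  by apply/setP => p; rewrite in_setI in_set1 in_set0; case: eqVneq => // ->; exact: negbTE.
rewrite eqxx big1 ?subrr // => F iF; case: eqP => // eF.
by rewrite eF in_setC iav in iF.
Qed.

(** With x_G expanded over [T] containing [G], every [T] contains some [j] of [G] outside [F];
    toggling an [i] of [F] outside [G] preserves the degree by [avoidable_toggle] and reverses the
    sign. *)
Lemma deg_gensJ1 m (F G : PF) : incomparable F G ->
  deg ('X_[m] * to_h (xF F * xF G)) = 0.
Proof.
move=> /andP[/subsetPn[i iF iG] /subsetPn[j jG jF]].
rewrite rmorphM /= !to_h_xF [x_in_h (val F) * _]mulrC mulrA.
have mulG p q : p * x_in_h (val G) * q = \sum_(T : {set 'I_n} | val G \subset T)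
    (- (-1) ^+ #|val G| * (-1) ^+ #|T|) *: (p * hvar T * q).
  rewrite /x_in_h mulr_sumr mulr_suml; apply: eq_bigr => T _.
  by rewrite -scalerAr -scalerAl.
rewrite mulG deg_sum.
under eq_bigr => T _.
  rewrite degZ -mpolyXD (degXx _ (PF_neqT F)).
  rewrite (avoidable_perm (mnm_sets_cons _ _)) -mulrA; over.
rewrite -mulr_sumr (altsum_toggle iG) ?mulr0 // => T sGT iT.
congr (_ && _)%:R; first by rewrite !mdegD !mdeg1.
by apply: (avoidable_toggle _ iF _ jF); apply: (subsetP sGT).
Qed.

Lemma deg_gensJ2 m i (F : PF) : i \notin val F ->
  deg ('X_[m] * to_h (yi _ i * xF F)) = 0.
Proof.
move=> iF; rewrite rmorphM /= to_h_yi to_h_xF mulrA -mpolyXD (degXx _ (PF_neqT F)).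
rewrite (avoidable_perm (mnm_sets_cons _ _)).
case: (val F =P _) => [eF|_]; last by rewrite andbF.
move: iF; rewrite eF in_setC negbK avoidable_cons => /existsP[t /and3P[]].
by rewrite inE => /eqP->; rewrite eqxx.
Qed.

Lemma deg_inIdeal (p : P) : inIdeal p -> deg (to_h p) = 0.
Proof.
case=> c ->; rewrite rmorph_sum deg_sum big1 // => l _.
rewrite rmorphM; apply: deg_kill => m.
have : (gens (@urank n k))`_l \in gens (@urank n k) by exact: mem_nth.
rewrite {2}/gens !mem_cat => /orP[/mapP[i _ ->]|/orP[|]].
- exact: deg_gensI.
- by case/mapP=> -[F G]; rewrite mem_enum => ? ->; exact: deg_gensJ1.
- by case/mapP=> -[i F]; rewrite mem_enum => ? ->; exact: deg_gensJ2.
Qed.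

(** The two factors are different polynomials; they only agree under the degree map, monomial by
    monomial. *)
Lemma deg_top (q : {mpoly rat[N]}) : deg (q * to_h (\sum_(F : PF) xF F)) = deg (q * hvar setT).
Proof.
apply/eqP; rewrite -subr_eq0 -degB -mulrBr; apply/eqP; apply: deg_kill => m.
rewrite mulrBr degB degXh rmorph_sum /= mulr_sumr deg_sum setTI.
under eq_bigr => F _ do rewrite to_h_xF (degXx _ (PF_neqT F)).
case: eqP => [mk|] /=; last by rewrite big1 ?subrr.
case: (eqVneq (avoidable (mnm_sets m)) set0) => [e|ne]; last first.
  by rewrite (@sum_PF _ predT) // subrr.
rewrite e setC0 big1 ?subrr // => F _.
by rewrite (negPf (PF_neqT F)).
Qed.

Lemma top_notin_ideal : ~ inIdeal ((\sum_(F : PF) xF F) ^+ k).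
Proof.
move=> /deg_inIdeal; rewrite rmorphXn => /eqP; apply/negP.
have top a q : deg (q * to_h (\sum_(F : PF) xF F) ^+ a) = deg (q * hvar setT ^+ a).
  elim: a q => [|a IH] q; first by rewrite !expr0.
  by rewrite [_ ^+ a.+1]exprS mulrA IH mulrAC deg_top -mulrA -exprSr.
rewrite -[X in deg X]mul1r top mul1r /hvar mpolyXn degX mdegMn mdeg1 mul1n eqxx /=.
suff -> : [exists X, sdr (mnm_sets (U_(enum_rank setT) *+ k)) X] by [].
apply/existsP; exists [set widen_ord le_kn i | i : 'I_k].
have pe : perm_eq (mnm_sets (U_(enum_rank setT) *+ k)) (nseq k setT).
  apply/allP => T _; apply/eqP; rewrite count_mnm_sets mulmnE mnm1E count_nseq.
  by rewrite (inj_eq enum_rank_inj).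
rewrite (sdr_perm pe) sdr_nseqT card_imset ?card_ord // => i1 i2 /(congr1 val) /= e.
exact: val_inj.
Qed.

End Degree.

(** * Quotient by an ideal given as a proposition *)

Section QuotientByProp.
Variables (R : comNzRingType) (J : R -> Prop).
Hypothesis J0 : J 0.
Hypothesis J1 : ~ J 1.
Hypothesis Jlin : forall a u v, J u -> J v -> J (a * u + v).

(** Ideal membership is an existential statement; classical reflection supplies the boolean
    predicate required by ring quotients. *)
Definition ideal_pred (u : R) : bool := `[< J u >].

Lemma ideal_pred_closed : idealr_closed ideal_pred.
Proof.
split; first exact/asboolP.
  by apply/negP => /asboolP.
by move=> a u v /asboolP Ju /asboolP Jv; apply/asboolP; apply: Jlin.
Qed.

HB.instance Definition _ := isIdealr.Build R ideal_pred ideal_pred_closed.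

Lemma quotient_exists :
  exists (A : comNzRingType) (pi : {rmorphism R -> A}), forall u, pi u = 0 <-> J u.
Proof.
pose I0 : idealr R := ideal_pred.
exists {ideal_quot I0}, (\pi_{ideal_quot I0})%qT => u.
split=> [u0|Ju].
  have : (u == 0 %[mod {ideal_quot I0}])%qT by rewrite u0 rmorph0.
  by rewrite -Quotient.idealrBE subr0 => /asboolP.
have : (u == 0 %[mod {ideal_quot I0}])%qT.
  by rewrite -Quotient.idealrBE subr0; apply/asboolP.
by move/eqP => e; apply: etrans e (rmorph0 _).
Qed.

End QuotientByProp.

(** * Dimensions of the graded pieces *)

Section Dimension.
Variables (n k : nat).
Hypothesis k_gt0 : (0 < k)%N.
Hypothesis le_kn : (k <= n)%N.
Implicit Types (S T F G : {set 'I_n}).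
Local Notation rk := (@urank n k).
Local Notation P := (Defs.Poly rk).
Local Notation PF := (PFlat rk).
Local Notation idx := (nat * seq ({set 'I_n} * nat))%type.

Lemma inIdeal0 : inIdeal (0 : P).
Proof. by exists [::]; rewrite big1 // => l _; rewrite nth_nil mul0r. Qed.

Lemma inIdeal_lin (a u v : P) : inIdeal u -> inIdeal v -> inIdeal (a * u + v).
Proof.
case=> c -> [d ->]; exists (mkseq (fun l => a * c`_l + d`_l) (size (gens rk))).
rewrite mulr_sumr -big_split; apply: eq_bigr => l _.
by rewrite nth_mkseq // mulrDl mulrA.
Qed.

Lemma inIdeal_gen (g : P) : g \in gens rk -> inIdeal g.
Proof.
move=> /(nthP 0)[l0 lt <-]; exists (mkseq (fun l => (l == l0)%:R) (size (gens rk))).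
rewrite (bigD1 (Ordinal lt)) //= nth_mkseq // eqxx mul1r big1 ?addr0 // => l nl.
by rewrite nth_mkseq // -val_eqE in nl *; rewrite (negPf nl) mul0r.
Qed.

Lemma one_notin_ideal : ~ inIdeal (1 : P).
Proof.
move=> in1; apply: (top_notin_ideal k_gt0 le_kn).
have := inIdeal_lin ((\sum_(F : PF) xF F) ^+ k) in1 inIdeal0.
by rewrite mulr1 addr0.
Qed.

Definition hpoly S : P := \sum_(F : PF | ~~ (S \subset val F)) xF F.
Definition nested_mono (f : idx) : P := \prod_(S <- nested_sets f) hpoly S.

Lemma hpoly_homog S : hpoly S \is 1.-homog.
Proof. by apply: rpred_sum => F _; rewrite dhomogX /= mdeg1. Qed.

Lemma nested_mono_homog f : nested_mono f \is (size (nested_sets f)).-homog.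
Proof.
rewrite /nested_mono; elim: (nested_sets f) => [|S L IH]; first by rewrite big_nil dhomog1.
by rewrite big_cons -[size _]add1n; apply: dhomogM (hpoly_homog S) IH.
Qed.

Variables (A : comNzRingType) (pi : {rmorphism P -> A}).
Hypothesis ker_pi : forall u, pi u = 0 <-> inIdeal u.

Definition xA F : A := if insub F is Some f then pi (xF (f : PF)) else 0.

Lemma xA_val (F : PF) : xA (val F) = pi (xF F).
Proof. by rewrite /xA valK. Qed.

Lemma xA_big F : (k <= #|F|)%N -> xA F = 0.
Proof.
by move=> kF; rewrite /xA insubN // (proper_flatE k_gt0 le_kn) -leqNgt.
Qed.

Lemma xA_incomp F G : incomp F G -> xA F * xA G = 0.
Proof.
rewrite /xA; case: insubP => [f _ <-|_ _]; last by rewrite mul0r.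
case: insubP => [g _ <-|_ _]; last by rewrite mulr0.
move=> nfg; rewrite -rmorphM; apply/ker_pi/inIdeal_gen.
rewrite /gens !mem_cat; apply/orP; right; apply/orP; left.
by apply/mapP; exists (f, g); rewrite // mem_enum.
Qed.

Lemma hA_hpoly S : hsum xA S = pi (hpoly S).
Proof.
rewrite /hsum /hpoly rmorph_sum (bigID (proper_flat rk)) /=.
rewrite [X in _ + X]big1 ?addr0; last first.
  by move=> F /andP[_ nF]; rewrite /xA insubN.
under [RHS]eq_bigr => F _ do rewrite -xA_val.
rewrite [RHS]big_mkcond /= big_mkcondl /=.
exact: (big_sub (proper_flat rk : {pred {set 'I_n}})
  (fun F : {set 'I_n} => if ~~ (S \subset F) then xA F else 0)).
Qed.

Lemma hA_yi i : hsum xA [set i] = pi (yi rk i).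
Proof.
apply/esym/eqP; rewrite hA_hpoly -subr_eq0 -rmorphB; apply/eqP/ker_pi/inIdeal_gen.
rewrite /gens mem_cat; apply/orP; left; apply/mapP; exists i; first by rewrite mem_enum.
by congr (_ - _); apply: eq_bigl => F; rewrite sub1set.
Qed.

Lemma hA_xA i F : i \notin F -> hsum xA [set i] * xA F = 0.
Proof.
rewrite hA_yi /xA; case: insubP => [f _ <-|_ _]; last by rewrite mulr0.
move=> iF; rewrite -rmorphM; apply/ker_pi/inIdeal_gen.
rewrite /gens !mem_cat; apply/orP; right; apply/orP; right.
by apply/mapP; exists (i, f); rewrite // mem_enum.
Qed.

Lemma pi_nested_mono f : pi (nested_mono f) = hprod xA (nested_sets f).
Proof.
by rewrite /nested_mono rmorph_prod; apply: eq_bigr => S _; rewrite hA_hpoly.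
Qed.

Lemma hA_top : hsum xA setT ^+ k != 0.
Proof.
rewrite hA_hpoly -rmorphXn; apply/eqP => /ker_pi.
have -> : hpoly setT = \sum_(F : PF) xF F.
  apply: eq_bigl => F; rewrite subTset; exact: PF_neqT.
exact: top_notin_ideal.
Qed.

Definition scal : {rmorphism rat -> A} := (pi \o @mpolyC _ rat : {rmorphism rat -> A}).

Lemma pi_scale a u : pi (a *: u) = scal a * pi u.
Proof. by rewrite -mul_mpolyC rmorphM. Qed.

Variables (j : nat) (B : seq idx).
Hypothesis uniqB : uniq B.
Hypothesis memB : forall f : idx, (f \in B) = nested k f && (size (nested_sets f) == j).

Let inspan := inspan xA B scal.

Lemma span_var (v : Var rk) (L : seq {set 'I_n}) q :
  (forall S, inspan (hprod xA (S :: L) * q)) -> inspan (hprod xA L * (pi (var v) * q)).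
Proof.
move=> spL.
have [c ->] : exists c : {set 'I_n} -> rat, pi (var v) = \sum_S scal (c S) * hsum xA S.
  case: v => [F|i].
    have := span_x xA_big le_kn scal (val F); by rewrite xA_val.
  exists (fun S => (S == [set i])%:R); rewrite (bigD1 [set i]) //= eqxx rmorph1 mul1r.
  rewrite hA_yi big1 ?addr0 // => S /negPf->; by rewrite rmorph0 mul0r.
rewrite mulr_suml mulr_sumr; apply: inspan_sum => S _.
have -> : hprod xA L * (scal (c S) * hsum xA S * q) = scal (c S) * (hprod xA (S :: L) * q).
  by rewrite hprod_cons; ring.
by apply: inspanZ; apply: spL.
Qed.

(** The variables of ['X_[m]] are traded one at a time for factors h_S, which accumulate in [L]. *)
Lemma span_mono m L : (mdeg m + size L)%N = j -> inspan (hprod xA L * pi 'X_[m]).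
Proof.
move: {2}(mdeg m) (erefl (mdeg m)) => q; elim: q m L => [|q IH] m L mq szL.
  move/eqP: mq; rewrite mdeg_eq0 => /eqP m0; rewrite m0 mpolyX0 rmorph1 mulr1.
  by apply: (inspan_hprod xA_big xA_incomp hA_xA scal uniqB memB); rewrite -szL m0 mdeg0.
have [i mi] : exists i, m i != 0%N.
  apply/existsP; apply: contra_eqT mq => /existsPn m0.
  by rewrite mdegE big1 // => i _; apply/eqP; have := m0 i; rewrite negbK.
have em : m = (U_(i) + (m - U_(i)))%MM by rewrite addmC submK // lep1mP.
have mq' : mdeg (m - U_(i)) = q by move: mq; rewrite {1}em mdegD mdeg1 => -[].
rewrite em mpolyXD rmorphM -[i]enum_valK; apply: span_var => S.
by rewrite enum_valK; apply: IH => //=; rewrite mq' -szL mq addSnnS.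
Qed.

Lemma span_homog p : p \is j.-homog -> inspan (pi p).
Proof.
move=> /dhomogP hp; rewrite [p]mpolyE rmorph_sum big_seq.
apply: inspan_sum => m mp; rewrite pi_scale; apply: inspanZ.
rewrite -[pi 'X_[m]]mul1r.
have := @span_mono m [::]; rewrite /hprod big_nil addn0; apply.
exact: hp.
Qed.

Lemma isDimCH_size : @isDimCH n rk j (size B).
Proof.
pose f0 : idx := (0%N, [::]).
have nthB (F : idx -> A) : \sum_(f <- B) F f = \sum_(i < size B) F (nth f0 B i).
  by rewrite (big_nth f0) big_mkord.
split.
  exists (fun i => nested_mono (nth f0 B i)); split.
    move=> i; have : nth f0 B i \in B by apply: mem_nth.
    by rewrite memB => /andP[_ /eqP <-]; apply: nested_mono_homog.
  move=> a /ker_pi; rewrite rmorph_sum => sum0.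
  pose c (f : idx) := if insub (index f B) is Some i then a i else 0.
  have cE (i : 'I_(size B)) : c (nth f0 B i) = a i.
    by rewrite /c index_uniq // valK.
  have H := @nested_indep _ _ _ _ xA_big xA_incomp hA_xA le_kn j B scal uniqB memB c hA_top.
  move=> i; rewrite -cE; apply: H; last exact: mem_nth.
  rewrite nthB -[RHS]sum0; apply: eq_bigr => l _.
  by rewrite pi_scale pi_nested_mono cE.
move=> d ltd [f [homf indf]].
have [c cE] := fin_all_exists (fun i => span_homog (homf i)).
(* Coordinates of the family on the nested products: with more rows than columns, a nonzero left
   kernel vector is a relation modulo the ideal. *)
pose C : 'M[rat]_(d, size B) := \matrix_(i, l) c i (nth f0 B l).
have kerC : kermx C != 0.
  rewrite -mxrank_eq0 mxrank_ker subn_eq0 -ltnNge.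
  exact: leq_ltn_trans (rank_leq_col _) ltd.
case/rowV0Pn: kerC => v /sub_kermxP vC; apply/negP; rewrite negbK; apply/eqP.
apply/rowP => i; rewrite mxE; apply: (indf (fun i => v 0 i)).
apply/ker_pi; rewrite rmorph_sum.
under eq_bigr => l _ do rewrite pi_scale cE nthB mulr_sumr.
rewrite exchange_big big1 //= => l _.
under eq_bigr => l' _ do rewrite mulrA -(rmorphM scal).
rewrite -mulr_suml -(rmorph_sum scal) (_ : \sum_l' _ = 0) ?rmorph0 ?mul0r //.
have /rowP/(_ l) := vC; rewrite !mxE; apply: etrans.
by apply: eq_bigr => l' _; rewrite mxE.
Qed.

End Dimension.

Lemma dimCH n k j (B : seq (nat * seq ({set 'I_n} * nat))) :
  (0 < k)%N -> (k <= n)%N -> uniq B ->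
  (forall f, (f \in B) = nested k f && (size (nested_sets f) == j)) ->
  @isDimCH n (@urank n k) j (size B).
Proof.
move=> k0 le_kn uB mB.
have [A [pi ker_pi]] := quotient_exists (@inIdeal0 n k)
  (one_notin_ideal k0 le_kn) (@inIdeal_lin n k).
exact: (isDimCH_size k0 le_kn ker_pi uB mB).
Qed.

(** * Generating function of the nested products *)

Definition qint (m : nat) : {poly int} := \sum_(i < m) 'X^i.

Lemma qint0 : qint 0 = 0. Proof. by rewrite /qint big_ord0. Qed.
Lemma qintS m : qint m.+1 = 'X^m + qint m.
Proof. by rewrite /qint big_ord_recr addrC. Qed.
Lemma qintSl m : qint m.+1 = 1 + 'X * qint m.
Proof.
rewrite /qint big_ord_recl expr0 mulr_sumr; congr (_ + _).
by apply: eq_bigr => i _; rewrite -exprS.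
Qed.
Lemma qint_geom m : (1 - 'X) * qint m = 1 - 'X^m.
Proof.
elim: m => [|m IH]; first by rewrite qint0 mulr0 subrr.
by rewrite qintS mulrDr IH exprS; ring.
Qed.

(* [N] only bounds the recursion depth. *)
Fixpoint chain_poly_rec (N c : nat) : {poly int} :=
  'X * qint c + (if N is N'.+1 then
    \sum_(c' < c) 'X * qint (c - c').-1 * chain_poly_rec N' c' *+ 'C(c, c') else 0).

Section Enumeration.
Variables (n k : nat).
Hypothesis le_kn : (k <= n)%N.
Implicit Types (S T : {set 'I_n}) (s : seq ({set 'I_n} * nat)).

Fixpoint chains (N : nat) S : seq (seq ({set 'I_n} * nat)) :=
  [::] :: (if N is N'.+1 then
    [seq (T, p.1) :: p.2 | T <- enum [pred T : {set 'I_n} | (T \proper S) && (#|T| < k)%N],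
       p <- [seq (a, s) | s <- chains N' T, a <- iota 1 (chain_dim k T s)]] else [::]).

Lemma mem_chains N S s : (s \in chains N S) = chain_below k S s && (size s <= N)%N.
Proof.
elim: N S s => [|N IH] S [|[T a] s] //=; rewrite ?inE ?eqxx ?andbF //=.
apply/allpairsPdep/idP => [[T' [p [T'S /allpairsPdep[s' [a' [s's a'i ->]]]]]]|].
  case=> -> -> ->; move: T'S s's a'i; rewrite mem_enum inE IH mem_iota add1n ltnS.
  by move=> /andP[-> ->] /andP[-> lt] ->; rewrite ltnS lt.
case/andP=> /and4P[TS Tk a0 gs] sN; exists T, (a, s); split=> //.
  by rewrite mem_enum inE TS.
apply/allpairsPdep; exists s, a; split=> //; first by rewrite IH gs.
by rewrite mem_iota add1n ltnS.
Qed.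

Lemma uniq_chains N S : uniq (chains N S).
Proof.
elim: N S => [//|N IH] S; apply/andP; split.
  by apply/negP => /allpairsPdep[T [p []]].
apply: allpairs_uniq_dep; first exact: enum_uniq.
  move=> T _; apply: allpairs_uniq_dep => //; first by move=> s _; apply: iota_uniq.
  by move=> [s1 a1] [s2 a2] _ _ /= [-> ->].
by move=> [T1 [a1 s1]] [T2 [a2 s2]] _ _ /= [-> -> ->].
Qed.

Lemma size_chain_below S s : chain_below k S s -> (size s <= #|S|)%N.
Proof.
elim: s S => [//|[T a] s IH] S /= /and4P[TS _ _ /IH le].
exact: leq_ltn_trans le (proper_card TS).
Qed.

Lemma sum_subsets (R : nmodType) (g : nat -> R) S b :
  \sum_(T : {set 'I_n} | (T \subset S) && (#|T| < b)%N) g #|T|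
    = \sum_(c < b) g c *+ 'C(#|S|, c).
Proof.
transitivity (\sum_(T : {set 'I_n} | (T \subset S) && (#|T| < b)%N)
    \sum_(c < b | #|T| == c) g c).
  apply: eq_bigr => T /andP[_ lt]; rewrite (bigD1 (Ordinal lt)) //= big1 ?addr0 //.
  by move=> c /andP[/eqP e /eqP]; case; apply: val_inj.
rewrite (exchange_big_dep predT) //=; apply: eq_bigr => c _.
rewrite sumr_const -cards_draws; congr (_ *+ _); apply: eq_card => T.
rewrite [RHS]inE unfold_in -andbA; case: (T \subset S) => //=.
by case: (#|T| =P c) => [->|]; rewrite ?ltn_ord ?andbF.
Qed.

Definition chain_gf N S : {poly int} :=
  \sum_(s <- chains N S) \sum_(a <- iota 1 (chain_dim k S s)) 'X^(a + size (expand s)).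

Lemma sum_iota1 m d : \sum_(a <- iota 1 m) 'X^(a + d) = 'X * qint m * 'X^d :> {poly int}.
Proof.
rewrite -[1%N]addn0 iotaDl big_map /qint -(big_mkord predT) /index_iota subn0.
rewrite mulr_sumr mulr_suml; apply: eq_bigr => i _.
by rewrite add1n addSn exprS exprD mulrA.
Qed.

Lemma sum_iota0 m d : \sum_(a <- iota 0 m) 'X^(a + d) = qint m * 'X^d :> {poly int}.
Proof.
rewrite /qint -(big_mkord predT) /index_iota subn0.
by rewrite mulr_suml; apply: eq_bigr => i _; rewrite exprD.
Qed.

Lemma big_chains N S (f : seq ({set 'I_n} * nat) -> {poly int}) :
  \sum_(s <- chains N.+1 S) f s = f [::] +
    \sum_(T : {set 'I_n} | (T \proper S) && (#|T| < k)%N)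
      \sum_(s <- chains N T) \sum_(a <- iota 1 (chain_dim k T s)) f ((T, a) :: s).
Proof.
rewrite /= big_cons; congr (_ + _); rewrite big_allpairs_dep big_enum_cond /=.
by apply: eq_big => [T|T _]; rewrite ?andbT // big_allpairs_dep.
Qed.

Lemma chain_gfE N S : (#|S| < k)%N -> chain_gf N S = chain_poly_rec N #|S|.
Proof.
elim: N S => [|N IH] S ltSk.
  rewrite /chain_gf [chains _ _]/= big_seq1 sum_iota1 expr0 mulr1.
  by rewrite /chain_dim urank_small //= addr0.
rewrite /chain_gf big_chains sum_iota1 expr0 mulr1 /chain_dim urank_small //=.
congr (_ + _); rewrite -(sum_subsets (fun c => 'X * qint (#|S| - c).-1 * chain_poly_rec N c)).
apply: eq_big => [T|T /andP[TS Tk]].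
  rewrite properEcard; case: (T \subset S) => //=.
  by apply/andb_idr => lt; apply: ltn_trans ltSk.
rewrite -IH // /chain_gf mulr_sumr; apply: eq_bigr => s _.
rewrite mulr_sumr; apply: eq_bigr => a _.
by rewrite sum_iota1 !urank_small // expand_cons size_cat size_nseq.
Qed.

Definition nested_seq : seq (nat * seq ({set 'I_n} * nat)) :=
  [seq (a, s) | s <- chains n setT, a <- iota 0 (chain_dim k setT s).+1].

Lemma mem_nested_seq f : (f \in nested_seq) = nested k f.
Proof.
case: f => a s; apply/allpairsPdep/andP => [[s' [a' [s's a'i [-> ->]]]]|[gs le]].
  by move: s's a'i; rewrite mem_chains mem_iota add0n ltnS => /andP[-> _].
exists s, a; split=> //; last by rewrite mem_iota add0n ltnS.
by rewrite mem_chains gs; have := size_chain_below gs; rewrite cardsT card_ord.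
Qed.

Lemma uniq_nested_seq : uniq nested_seq.
Proof.
apply: allpairs_uniq_dep; first exact: uniq_chains.
  by move=> s _; apply: iota_uniq.
by move=> [s1 a1] [s2 a2] _ _ /= [-> ->].
Qed.

(** The full set may have multiplicity zero: alone it has k + 1 possible exponents, and k - c above
    a set of size c. *)
Lemma nested_gf : (0 < k)%N -> \sum_(f <- nested_seq) 'X^(size (nested_sets f)) =
  qint k.+1 + \sum_(c < k) qint (k - c) * chain_poly_rec n.-1 c *+ 'C(n, c).
Proof.
move=> k0; have n0 : (0 < n)%N by apply: leq_trans le_kn.
rewrite big_allpairs_dep -[X in chains X](prednK n0).
under eq_bigr => s _ do under eq_bigr => a _ do rewrite size_cat size_nseq.
under eq_bigr => s _ do rewrite sum_iota0.
have cT : chain_dim k (setT : {set 'I_n}) [::] = k by rewrite /chain_dim urankT.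
rewrite (big_chains _ _ (fun s => qint (chain_dim k setT s).+1 * 'X^(size (expand s)))).
rewrite cT expr0 mulr1; congr (_ + _).
have := sum_subsets (fun c => qint (k - c) * chain_poly_rec n.-1 c) setT k.
rewrite cardsT card_ord => <-.
apply: eq_big => [T|T /andP[TS Tk]].
  rewrite subsetT properEcard subsetT cardsT card_ord /=.
  by apply/andb_idl => lt; apply: leq_trans le_kn.
rewrite -chain_gfE // /chain_gf mulr_sumr; apply: eq_bigr => s _.
rewrite mulr_sumr; apply: eq_bigr => a _.
rewrite expand_cons size_cat size_nseq /chain_dim urankT // urank_small //.
by rewrite prednK // subn_gt0.
Qed.

Lemma nested_count j :
  (\sum_(f <- nested_seq) 'X^(size (nested_sets f)) : {poly int})`_j
    = (size [seq f <- nested_seq | size (nested_sets f) == j])%:Z.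
Proof.
rewrite coef_sum; elim: nested_seq => [|f L IH]; first by rewrite big_nil.
by rewrite big_cons IH coefXn eq_sym /=; case: eqP => _; rewrite ?add0r // -PoszD.
Qed.

End Enumeration.

Lemma chain_poly_rec_stable N M c : (c <= N)%N -> (c <= M)%N ->
  chain_poly_rec N c = chain_poly_rec M c.
Proof.
elim/ltn_ind: c N M => c IH N M cN cM.
case: c IH cN cM => [|c] IH cN cM.
  by case: N M {cN cM} => [|N] [|M] /=; rewrite ?big_ord0.
case: N M cN cM => [|N] [|M] // cN cM /=; congr (_ + _).
apply: eq_bigr => c' _; congr (_ * _ *+ _); apply: IH => //.
  exact: leq_trans (ltn_ord c') cN.
exact: leq_trans (ltn_ord c') cM.
Qed.

(* For [c > 0], the generating function by total multiplicity of the nested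
   products with largest set a given proper flat of size [c] (in fact ['X] times the
   Eulerian polynomial). *)
Definition chain_poly (c : nat) : {poly int} := if c is 0 then 1 else chain_poly_rec c c.

(** The value 1 at zero absorbs the one-set chains: x [c] = x^c + x [c-1], whose second term is the
    summand [c' = 0]. *)
Lemma chain_polyE c : chain_poly c =
  'X^c + \sum_(c' < c) 'X * qint (c - c').-1 * chain_poly c' *+ 'C(c, c').
Proof.
case: c => [|c]; first by rewrite big_ord0 addr0.
have V0 : chain_poly_rec c 0 = 0 by rewrite (@chain_poly_rec_stable _ 0) //= qint0 mulr0 addr0.
rewrite [LHS]/= !big_ord_recl /= V0 mulr0 mul0rn add0r mulr1 bin0 mulr1n.
rewrite qintS mulrDr -exprS -addrA; congr (_ + (_ + _)); apply: eq_bigr => i _.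
by rewrite (@chain_poly_rec_stable _ i.+1).
Qed.

(** * Umbral calculus for the chain polynomials *)

Section Umbral.
Local Notation R := {poly int}.
Local Notation u := (1 - 'X : R).

(* The linear form ['X^c |-> chain_poly c] turns binomial convolutions with
   powers into shifts of the variable. *)
Definition umbral (f : {poly R}) : R := \sum_(i < size f) f`_i * chain_poly i.

Lemma umbralE m (f : {poly R}) : (size f <= m)%N -> umbral f = \sum_(i < m) f`_i * chain_poly i.
Proof.
move=> le; rewrite /umbral (big_ord_widen m (fun i => f`_i * chain_poly i)) // big_mkcond.
by apply: eq_bigr => i _; case: ltnP => // ge; rewrite nth_default ?mul0r.
Qed.

Lemma umbralD f g : umbral (f + g) = umbral f + umbral g.
Proof.
pose m := maxn (size f) (size g).
rewrite (@umbralE m) ?size_polyD // (@umbralE m f) ?leq_maxl // (@umbralE m g) ?leq_maxr //.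
by rewrite -big_split; apply: eq_bigr => i _; rewrite coefD mulrDl.
Qed.

Lemma umbralZ a f : umbral (a *: f) = a * umbral f.
Proof.
rewrite (@umbralE (size f)) ?size_scale_leq // mulr_sumr.
by apply: eq_bigr => i _; rewrite coefZ mulrA.
Qed.

Lemma umbral0 : umbral 0 = 0.
Proof. by rewrite /umbral size_poly0 big_ord0. Qed.

Lemma umbral_sum (I : Type) (r : seq I) (P : pred I) (F : I -> {poly R}) :
  umbral (\sum_(i <- r | P i) F i) = \sum_(i <- r | P i) umbral (F i).
Proof. exact: (big_morph _ umbralD umbral0). Qed.

Lemma umbralXn c : umbral 'X^c = chain_poly c.
Proof.
rewrite (@umbralE c.+1) ?size_polyXn // big_ord_recr /= coefXn eqxx mul1r.
by rewrite big1 ?add0r // => i _; rewrite coefXn (ltn_eqF (ltn_ord i)) mul0r.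
Qed.

Lemma umbral_XaddC c a :
  umbral (('X + a%:P) ^+ c) = \sum_(i < c.+1) a ^+ (c - i) * chain_poly i *+ 'C(c, i).
Proof.
rewrite addrC exprDn umbral_sum; apply: eq_bigr => i _.
by rewrite -polyC_exp mul_polyC -scaler_nat !umbralZ umbralXn mulr_natl.
Qed.

(** This is [chain_polyE] times 1 - x, which turns each q-integer into a difference of powers and
    the sum into two binomial convolutions. *)
Lemma umbral_pow c :
  'X * umbral (('X + 1%:P) ^+ c) = umbral (('X + 'X%:P) ^+ c) - u * 'X^c.
Proof.
rewrite !umbral_XaddC [X in _ * X]big_ord_recr [X in X - _]big_ord_recr /=.
rewrite !subnn !expr0 !mul1r !binn !mulr1n.
have e := congr1 (fun y => u * y) (chain_polyE c); rewrite /= mulrDr mulr_sumr in e.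
have {}e : u * chain_poly c = u * 'X^c +
    \sum_(i < c) ('X * (1 ^+ (c - i) * chain_poly i *+ 'C(c, i))
      - 'X ^+ (c - i) * chain_poly i *+ 'C(c, i)).
  rewrite e; congr (_ + _); apply: eq_bigr => i _.
  have -> : 'X ^+ (c - i) = 'X * 'X ^+ (c - i).-1 :> R.
    by rewrite -exprS prednK // subn_gt0.
  rewrite !mulrnAr -mulrnBl; congr (_ *+ _).
  transitivity ('X * chain_poly i * (u * qint (c - i).-1)); first by ring.
  by rewrite qint_geom expr1n; ring.
rewrite sumrB -mulr_sumr in e; rewrite mulrDr.
move: e; set s1 := \sum_(i < c) _; set s2 := \sum_(i < c) _ => e.
have -> : s2 = u * 'X^c + 'X * s1 - u * chain_poly c by rewrite e; ring.
ring.
Qed.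

Lemma umbral_shift1 f :
  'X * umbral (f \Po ('X + 1%:P)) = umbral (f \Po ('X + 'X%:P)) - u * f.['X].
Proof.
rewrite !comp_polyE !umbral_sum horner_coef !mulr_sumr -sumrB; apply: eq_bigr => i _.
rewrite !umbralZ mulrCA umbral_pow; ring.
Qed.

Lemma umbral_shift g :
  'X * umbral (g \Po ('X + u%:P)) = umbral g - u * g.[0].
Proof.
(* Translating by the inner indeterminate cancels one of the two shifts and turns the other into a
   shift by 1 - x. *)
have := umbral_shift1 (g \Po ('X - 'X%:P)).
rewrite horner_comp !hornerE subrr -!comp_polyA.
rewrite !comp_polyB !comp_polyX !comp_polyC.
have -> : 'X + 1%:P - 'X%:P = 'X + u%:P :> {poly R} by rewrite polyCB; ring.
by rewrite addrK comp_polyXr.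
Qed.

Lemma chain_poly_shift M :
  'X * \sum_(j < M.+1) u ^+ j * chain_poly (M - j) *+ 'C(M, j) = chain_poly M - u * (M == 0%N)%:R.
Proof.
have := umbral_shift 'X^M; rewrite umbralXn hornerXn expr0n comp_Xn_poly umbral_XaddC => <-.
congr (_ * _); rewrite (reindex_inj rev_ord_inj) /=; apply: eq_bigr => i _.
have iM : (i <= M)%N by rewrite -ltnS.
by rewrite subSS subKn // bin_sub.
Qed.

Lemma chain_poly_shiftS M :
  'X * \sum_(j < M.+1) u ^+ j * chain_poly (M - j).+1 *+ 'C(M, j)
    = chain_poly M.+1 - u * chain_poly M + u ^+ 2 * (M == 0%N)%:R.
Proof.
(* This polynomial is chosen because the shift by [u] turns its last factor into the variable,
   raising every index of [chain_poly] by one. *)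
have e1 : 'X^M * ('X - u%:P) = 'X^(M.+1) + (- u) *: 'X^M :> {poly R}.
  by rewrite mulrBr -exprSr scaleNr -mul_polyC [_ * u%:P]mulrC.
transitivity ('X * umbral ((('X^M * ('X - u%:P)) \Po ('X + u%:P)) : {poly R})); last first.
  rewrite umbral_shift {1}e1 umbralD umbralZ !umbralXn hornerM hornerXn
    expr0n hornerD hornerN hornerX hornerC.
  ring.
rewrite comp_polyM comp_Xn_poly comp_polyB comp_polyX comp_polyC addrK.
congr (_ * _); rewrite ['X + u%:P]addrC exprDn mulr_suml umbral_sum.
rewrite (reindex_inj rev_ord_inj); apply: eq_bigr => i _.
rewrite [nat_of_ord (rev_ord i)]/=.
have iM : (i <= M)%N by rewrite -ltnS.
rewrite subSS subKn // bin_sub // mulrnAl -[in RHS]scaler_nat umbralZ -mulrA -exprSr.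
by rewrite -polyC_exp mul_polyC umbralZ umbralXn mulr_natl.
Qed.

End Umbral.

Arguments chain_poly : simpl never.
Arguments qint : simpl never.

Lemma sum_triangle (W : nmodType) (F : nat -> nat -> W) k :
  \sum_(c < k) \sum_(d < k - c) F c d = \sum_(M < k) \sum_(j < M.+1) F j (M - j)%N.
Proof.
transitivity (\sum_(c < k) \sum_(M < k | (c <= M)%N) F c (M - c)%N).
  apply: eq_bigr => c _.
  rewrite -(big_mkord predT (F c)) -(big_mkord (leq c) (fun M => F c (M - c)%N)).
  rewrite [RHS](big_cat_nat (n := c)) //= ?(ltnW (ltn_ord c)) //.
  rewrite [X in _ = X + _]big_nat_cond [X in _ = X + _]big_pred0 ?add0r; last first.
    by move=> i; rewrite ltnNge; case: (c <= i)%N; rewrite ?andbF.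
  rewrite -[X in _ = \big[_/_]_(X <= _ < _ | _) _]add0n big_addn big_nat_cond [RHS]big_nat_cond.
  by apply: eq_big => [i|i _]; rewrite ?leq_addl ?addnK ?andbT.
rewrite (exchange_big_dep predT) //=; apply: eq_bigr => M _.
rewrite -(big_mkord predT (fun j => F j (M - j)%N)).
rewrite -(big_mkord (fun c => (c <= M)%N) (fun j => F j (M - j)%N)).
rewrite [LHS](big_cat_nat (n := M.+1)) //=.
rewrite [X in _ + X = _]big_nat_cond [X in _ + X = _]big_pred0 ?addr0; last first.
  by move=> i; rewrite ltnNge; case: (i <= M)%N; rewrite ?andbF.
by rewrite big_nat_cond [RHS]big_nat_cond; apply: eq_bigl => i; rewrite ltnS; case: (i <= M)%N.
Qed.

(** * One recursion for both sides *)

Section ClosedForm.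
Variable p : nat.
Local Notation R := {poly int}.
Local Notation u := (1 - 'X : R).

(* The Hilbert series of U_(k,p+k). *)
Definition hilb (k : nat) : R := 'X^k + \sum_(c < k) chain_poly c * qint (k - c) *+ 'C(p + k, c).

(** The counterpart of [prefix_total]: [hilbS] is to match [prefix_gf0S], with the index shifted by
    one. *)
Definition hilb_diff (k : nat) : R :=
  \sum_(c < k) (chain_poly c + chain_poly c.+1 * qint (k.-1 - c)) *+ 'C(p + k.-1, c).

Lemma hilbS k : hilb k.+1 = hilb_diff k.+1 + 'X * hilb k.
Proof.
have -> : hilb k = 'X^k + \sum_(c < k.+1) chain_poly c * qint (k - c) *+ 'C(p + k, c).
  by rewrite big_ord_recr /= subnn qint0 mulr0 mul0rn addr0.
rewrite /hilb /hilb_diff /= mulrDr -exprS addrCA; congr (_ + _).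
transitivity (\sum_(c < k.+1) chain_poly c * qint (k.+1 - c) *+ 'C(p + k, c)
   + \sum_(c < k.+1) chain_poly c.+1 * qint (k - c) *+ 'C(p + k, c)).
  rewrite [X in _ + X]big_ord_recr /= subnn qint0 mulr0 mul0rn addr0.
  rewrite !big_ord_recl /= !bin0 -addrA; congr (_ + _); rewrite -big_split /=.
  by apply: eq_bigr => i _; rewrite /bump /= !add1n addnS binS mulrnDr.
rewrite mulr_sumr -!big_split; apply: eq_bigr => c _ /=.
have ck : (c <= k)%N by rewrite -ltnS.
by rewrite subSn // qintSl mulrnAr -!mulrnDl; congr (_ *+ _); ring.
Qed.

Lemma binomial_trinomial N M j : (j <= M)%N -> (M <= N)%N ->
  ('C(N - j, M - j) * 'C(N, j) = 'C(N, M) * 'C(M, j))%N.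
Proof.
move=> jM MN; have jN := leq_trans jM MN.
apply/eqP; rewrite -(eqn_pmul2r (fact_gt0 j)) -(eqn_pmul2r (fact_gt0 (M - j))).
rewrite -(eqn_pmul2r (fact_gt0 (N - M))).
have e1 := bin_fact jN; have e2 := bin_fact jM; have e3 := bin_fact MN.
have e4 := @bin_fact (N - j) (M - j) (leq_sub2r _ MN).
rewrite subnBA // subnK // in e4; apply/eqP.
transitivity N`!; first by rewrite -e1 -e4; ring.
by rewrite -e3 -e2; ring.
Qed.

(** Grouped by M = c + d, the binomials factor as C(p+k, M) C(M, c) and the q-integer depends on M
    alone, so the inner sums are those of [chain_poly_shift] and [chain_poly_shiftS]. *)
Lemma hilb_diff_conv k :
  'X * \sum_(c < k.+1) u ^+ c * hilb_diff (k.+1 - c) *+ 'C(p + k, c)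
  = hilb_diff k.+1 - u * hilb k.
Proof.
pose F c d : R :=
  u ^+ c * (chain_poly d + chain_poly d.+1 * qint (k - c - d))
    *+ ('C(p + k - c, d) * 'C(p + k, c)).
transitivity ('X * \sum_(c < k.+1) \sum_(d < k.+1 - c) F c d).
  congr (_ * _); apply: eq_bigr => c _; have ck : (c <= k)%N by rewrite -ltnS.
  rewrite /hilb_diff mulr_sumr -sumrMnl subSn //; apply: eq_bigr => d _ /=.
  by rewrite /F mulrnA mulrnAr addnBA.
rewrite sum_triangle mulr_sumr.
have -> : hilb k = 'X^k + \sum_(c < k.+1) chain_poly c * qint (k - c) *+ 'C(p + k, c).
  by rewrite big_ord_recr /= subnn qint0 mulr0 mul0rn addr0.
transitivity (\sum_(M < k.+1) ((chain_poly M + chain_poly M.+1 * qint (k - M)) *+ 'C(p + k, M)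
   - u * (chain_poly M * qint (k - M) *+ 'C(p + k, M))
   - (u - u ^+ 2 * qint (k - M)) * (M == 0%N :> nat)%:R *+ 'C(p + k, M))).
  apply: eq_bigr => M _; have Mk : (M <= k)%N by rewrite -ltnS.
  transitivity (('X * \sum_(j < M.+1) u ^+ j * chain_poly (M - j) *+ 'C(M, j)
    + ('X * \sum_(j < M.+1) u ^+ j * chain_poly (M - j).+1 *+ 'C(M, j)) * qint (k - M))
       *+ 'C(p + k, M)).
    rewrite -mulrA -mulrDr mulr_suml -big_split -mulrnAr -sumrMnl; congr (_ * _).
    apply: eq_bigr => j _; have jM : (j <= M)%N by rewrite -ltnS.
    rewrite /F binomial_trinomial ?(leq_trans Mk) ?leq_addl // mulnC mulrnA.
    rewrite -subnDA subnKC //= mulrnAl -mulrnDl; congr (_ *+ _ *+ _); ring.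
  rewrite chain_poly_shift chain_poly_shiftS
    (mulrnAr u (chain_poly M * qint (k - M))) -!mulrnBl; congr (_ *+ _); ring.
rewrite !sumrB -mulr_sumr -/(hilb_diff k.+1) mulrDr opprD addrA -!addrA; congr (_ + _).
rewrite addrC; congr (_ - _); rewrite big_ord_recl big1 ?addr0; last first.
  by move=> i _; rewrite mulr0 mul0rn.
(* The correction at M = 0 is u (1 - u [k]) = u x^k, the leading term of [hilb k] times u. *)
rewrite /= bin0 mulr1 mulr1n subn0 expr2 -mulrA qint_geom; ring.
Qed.

Lemma one_subX_neq0 : u != 0.
Proof.
by apply/eqP => /(congr1 (fun q : R => q`_0)); rewrite coefB coef1 coefX coef0.
Qed.

(** Isolating c = 0 in [hilb_diff_conv] leaves a factor 1 - x on both sides; cancelling it gives the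
    recursion of [prefix_totalE]. *)
Lemma hilb_diff_rec k : hilb_diff k.+1 =
  hilb k + \sum_(c < k) 'X * u ^+ c * hilb_diff (k - c) *+ 'C(p + k, c.+1).
Proof.
apply: (mulfI one_subX_neq0); have := hilb_diff_conv k.
rewrite big_ord_recl /= bin0 mulr1n expr0 mul1r subn0 mulrDr => e.
set s := \sum_(c < k) _ in e; rewrite mulrDr.
have -> : u * \sum_(c < k) 'X * u ^+ c * hilb_diff (k - c) *+ 'C(p + k, c.+1) = 'X * s.
  rewrite !mulr_sumr; apply: eq_bigr => c _; rewrite !mulrnAr; congr (_ *+ _).
  by rewrite /bump /= add1n subSS exprS; ring.
have -> : 'X * s = hilb_diff k.+1 - u * hilb k - 'X * hilb_diff k.+1 by rewrite -e; ring.
ring.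
Qed.

Definition step_weight (a b : nat) : R :=
  if (a == 0%N) && (b == 0%N) then 1 + 'X else if (a < b)%N then 'X else 1.

(* Sum of the weights of the steps e_0 = 0, e_1, .., e_m = v with
   e_i < s_i = p + 1 + i. *)
Fixpoint prefix_gf (m v : nat) : R :=
  if m is m'.+1 then
    if (v < p + m'.+2)%N then \sum_(a < (p + m').+1) prefix_gf m' a * step_weight a v else 0
  else (v == 0%N)%:R.

Definition prefix_total m : R := \sum_(v < (p + m).+1) prefix_gf m v.

Lemma hockey_stick c L : (\sum_(i < L) 'C(i, c) = 'C(L, c.+1))%N.
Proof.
elim: L => [|L IH]; first by rewrite big_ord0.
by rewrite big_ord_recr IH binS.
Qed.

Lemma hockey_stick_rev c v P :
  (\sum_(a < P.+1 | v <= a) 'C(P - a, c) = 'C(P.+1 - v, c.+1))%N.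
Proof.
rewrite -hockey_stick (big_ord_widen P.+1 (fun i => 'C(i, c))) ?leq_subr //.
rewrite (reindex_inj rev_ord_inj) /=; apply: eq_big => [i|i _].
  by have := ltn_ord i; rewrite subSS ltnS; lia.
by rewrite subSS subKn // -ltnS.
Qed.

(* A step to [v > 0] has weight ['X + (1 - 'X) * (v <= a)]; the index [c] is the
   length of the maximal run of steps, ending at [v], in which the second term is
   chosen. *)
Lemma prefix_gf_tail m v : (0 < v <= p + m)%N ->
  prefix_gf m v = \sum_(c < m) 'X * u ^+ c * prefix_total (m.-1 - c) *+ 'C(p + m - v, c).
Proof.
elim: m v => [|m IH] v vm; first by rewrite big_ord0 /=; case: v vm.
have [v0 vle] := andP vm; rewrite addnS in vle.
have -> : prefix_gf m.+1 v = \sum_(a < (p + m).+1) prefix_gf m a * step_weight a v.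
  by rewrite /= !addnS ltnS vle.
have step_weightE a : step_weight a v = 'X + u * (v <= a)%:R.
  rewrite /step_weight -[v == 0%N]negbK -lt0n v0 andbF ltnNge.
  by case: leqP => _ /=; ring.
transitivity ('X * prefix_total m + u * \sum_(a < (p + m).+1 | (v <= a)%N) prefix_gf m a).
  rewrite /prefix_total !mulr_sumr [X in _ + X]big_mkcond -big_split; apply: eq_bigr => a _ /=.
  by rewrite step_weightE; case: leqP => _ /=; ring.
rewrite big_ord_recl /= bin0 mulr1n expr0 mulr1 subn0; congr (_ + _).
have -> : \sum_(a < (p + m).+1 | (v <= a)%N) prefix_gf m a =
    \sum_(a < (p + m).+1 | (v <= a)%N)
      \sum_(c < m) 'X * u ^+ c * prefix_total (m.-1 - c) *+ 'C(p + m - a, c).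
  apply: eq_bigr => a va; apply: IH; rewrite (leq_trans v0 va) /=.
  by rewrite -ltnS.
rewrite exchange_big mulr_sumr; apply: eq_bigr => c _ /=.
rewrite sumrMnr hockey_stick_rev mulrnAr addnS; congr (_ *+ _).
rewrite /bump /= add1n exprS.
by case: m c {IH vm vle} => [[]//|m] c; rewrite subSS; ring.
Qed.

Lemma prefix_totalE m : prefix_total m = prefix_gf m 0 +
  \sum_(c < m) 'X * u ^+ c * prefix_total (m.-1 - c) *+ 'C(p + m, c.+1).
Proof.
rewrite /prefix_total big_ord_recl; congr (_ + _).
transitivity (\sum_(v < (p + m).+1 | (1 <= v)%N) prefix_gf m v).
  by rewrite [RHS]big_mkcond [RHS]big_ord_recl /= add0r.
transitivity (\sum_(v < (p + m).+1 | (1 <= v)%N)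
    \sum_(c < m) 'X * u ^+ c * prefix_total (m.-1 - c) *+ 'C(p + m - v, c)).
  by apply: eq_bigr => v v0; apply: prefix_gf_tail; rewrite v0 /= -ltnS.
rewrite exchange_big; apply: eq_bigr => c _ /=.
by rewrite sumrMnr hockey_stick_rev subn1.
Qed.

Lemma prefix_gf0S m : prefix_gf m.+1 0 = prefix_total m + 'X * prefix_gf m 0.
Proof.
rewrite [prefix_gf m.+1 0]/= addnS ltn0Sn /prefix_total !big_ord_recl.
rewrite /step_weight /= addrAC mulrDr mulr1.
rewrite [_ * 'X]mulrC; congr (_ + _ + _).
by apply: eq_bigr => i _; rewrite mulr1.
Qed.

Lemma prefix_gf_closed m : prefix_gf m 0 = hilb m /\ prefix_total m = hilb_diff m.+1.
Proof.
elim/ltn_ind: m => m IH.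
have gw0 : prefix_gf m 0 = hilb m.
  case: m IH => [|m] IH; first by rewrite /hilb big_ord0 addr0.
  by have [e1 e2] := IH m (ltnSn m); rewrite prefix_gf0S e1 e2 hilbS.
split=> //; rewrite prefix_totalE gw0 hilb_diff_rec; congr (_ + _); apply: eq_bigr => c _.
have cm := ltn_ord c; have [|_ ->] := IH (m.-1 - c)%N; first by lia.
by congr (_ * hilb_diff _ *+ _); lia.
Qed.

End ClosedForm.

(** * From inversion sequences to the transfer recursion *)

Section Transfer.
Variables (p B : nat).

(** This is [ext] with a bound [B] independent of [m], so that it stays fixed in the induction on
    the length. *)
Definition entry m (e : {ffun 'I_m -> 'I_B}) (i : nat) : nat :=
  if i is j.+1 then
    match (insub j : option 'I_m) with Some j' => val (e j') | None => 0%N end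
  else 0%N.

Arguments entry : simpl never.

Definition valid m (e : {ffun 'I_m -> 'I_B}) : bool :=
  [forall i : 'I_m, (val (e i) < p + 1 + (val i).+1)%N].

Definition extend m (q : {ffun 'I_m -> 'I_B} * 'I_B) : {ffun 'I_m.+1 -> 'I_B} :=
  [ffun i => if unlift ord_max i is Some j then q.1 j else q.2].

Lemma extend_bij m : bijective (@extend m).
Proof.
exists (fun e : {ffun 'I_m.+1 -> 'I_B} =>
    ([ffun j : 'I_m => e (lift ord_max j)], e ord_max)) => [[e a]|e].
  by congr pair; [apply/ffunP => j; rewrite !ffunE liftK | rewrite ffunE unlift_none].
apply/ffunP => i; rewrite !ffunE; case: unliftP => [j ->|->] //.
by rewrite ffunE.
Qed.

Lemma entry_ord m (e : {ffun 'I_m -> 'I_B}) (i : 'I_m) : entry e i.+1 = e i.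
Proof. by rewrite /entry valK. Qed.

Lemma entry_extend m (e : {ffun 'I_m -> 'I_B}) a i : (i <= m)%N ->
  entry (extend (e, a)) i = entry e i.
Proof.
case: i => [//|i] im; rewrite -[i]/(val (Ordinal im)) entry_ord.
have -> : val (Ordinal im) = lift ord_max (Ordinal im) :> nat by rewrite lift_max.
by rewrite entry_ord ffunE liftK.
Qed.

Lemma entry_extend_last m (e : {ffun 'I_m -> 'I_B}) a :
  entry (extend (e, a)) m.+1 = a.
Proof. by rewrite -[m]/(val (@ord_max m)) entry_ord ffunE unlift_none. Qed.

Lemma valid_extend m (e : {ffun 'I_m -> 'I_B}) a :
  valid (extend (e, a)) = valid e && (a < p + 1 + m.+1)%N.
Proof.
have valL (j : 'I_m) : val (lift ord_max j) = j := lift_max j.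
apply/forallP/andP => [H|[/forallP H am] i].
  split; last by have := H ord_max; rewrite ffunE unlift_none.
  by apply/forallP => i; have := H (lift ord_max i); rewrite valL ffunE liftK.
rewrite ffunE; case: unliftP => [j ->|->] //.
by rewrite -/(val (lift _ _)) valL; apply: H.
Qed.

(** The free function [h] of the last entry absorbs the weight of the next step in the induction,
    and finally that of the closing step to zero. *)
Lemma transfer_sum m (h : nat -> {poly int}) : (forall i, i < m -> p + 1 + i.+1 <= B)%N ->
  \sum_(e : {ffun 'I_m -> 'I_B} | valid e)
     (\prod_(i < m) step_weight (entry e i) (entry e i.+1)) * h (entry e m)
  = \sum_(v < (p + m).+1) prefix_gf p m v * h v.
Proof.
elim: m h => [|m IH] h leB.
  rewrite (big_pred1 (ffun0 (card_ord 0))) => [|e]; last first.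
    have -> : valid e by apply/forallP => -[].
    by apply/esym/eqP/ffunP => -[].
  rewrite big_ord0 big_ord_recl /= big1 ?addr0 // => i _.
  by rewrite /bump /= mul0r.
rewrite (reindex _ (onW_bij _ (@extend_bij m))) /=.
have lepB : (p + 1 + m.+1 <= B)%N by apply: leB.
transitivity (\sum_(a < B | (a < p + 1 + m.+1)%N) \sum_(e : {ffun 'I_m -> 'I_B} | valid e)
    (\prod_(i < m) step_weight (entry e i) (entry e i.+1)) * (step_weight (entry e m) a * h a)).
  rewrite exchange_big /= pair_big_dep /=; apply: eq_big => [[e a]|[e a] _] /=.
    by rewrite valid_extend.
  rewrite big_ord_recr /= entry_extend_last entry_extend // -!mulrA; congr (_ * _).
  apply: eq_bigr => i _; by rewrite (entry_extend _ _ (ltnW (ltn_ord i))) entry_extend.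
transitivity (\sum_(a < B | (a < p + 1 + m.+1)%N) prefix_gf p m.+1 a * h a).
  apply: eq_bigr => a la; rewrite (IH (fun v => step_weight v a * h a)).
    rewrite [prefix_gf _ _ _]/= (_ : (p + m.+2 = p + 1 + m.+1)%N); last by lia.
    rewrite la mulr_suml.
    by apply: eq_bigr => v _; rewrite mulrA.
  by move=> i im; apply: leB; apply: ltnW.
rewrite -(big_ord_widen _ (fun a => prefix_gf p m.+1 a * h a) lepB).
by rewrite (_ : (p + 1 + m.+1 = (p + m.+1).+1)%N) //; lia.
Qed.

End Transfer.

Arguments entry : simpl never.

(** Cross-multiplied, a t + a is compared with b t; since a < t, the extra a is less than one
    multiple of t, and equality would make t divide a. *)
Lemma ratio_cmp (a b t : nat) : (a < t)%N ->
  ((a%:R / t%:R < b%:R / t.+1%:R :> rat) = (a < b)%N) *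
  ((a%:R / t%:R == b%:R / t.+1%:R :> rat) = (a == 0%N) && (b == 0%N)).
Proof.
move=> at_; have t0 : (0 < t)%N by apply: leq_ltn_trans at_.
have tr : 0 < t%:R :> rat by rewrite ltr0n.
have tr1 : 0 < t.+1%:R :> rat by rewrite ltr0n.
split.
  rewrite ltr_pdivrMr // mulrAC ltr_pdivlMr // -!natrM ltr_nat.
  by apply/idP/idP => H; nia.
rewrite eqr_div ?pnatr_eq0 -?lt0n // -!natrM eqr_nat.
apply/eqP/andP => [H|[/eqP-> /eqP->]]; last by rewrite !mul0n.
have a0 : a = 0%N by case: (posnP a) => // a0; case: (leqP b a) => ba; nia.
by rewrite a0 in H *; move/esym/eqP: H; rewrite mul0n muln_eq0 (gtn_eqF t0) orbF.
Qed.

Lemma Etilde_transfer p m : Etilde m (fun i => p + 1 + i)%N = prefix_gf p m.+1 0.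
Proof.
set s := (fun i => p + 1 + i)%N; set B := Ebound m s.
have leB i : (i < m -> p + 1 + i.+1 <= B)%N.
  by move=> im; apply: (leq_bigmax (F := fun i : 'I_m => s i.+1) (Ordinal im)).
have tr := transfer_sum (fun v => step_weight v 0) leB.
have -> : prefix_gf p m.+1 0 = \sum_(v < (p + m).+1) prefix_gf p m v * step_weight v 0.
  by rewrite [LHS]/= addnS.
rewrite -tr; apply: eq_bigr => e ve.
have last0 : entry e m.+1 = 0%N by rewrite /entry insubN // -leqNgt.
have entry_lt i : (i <= m)%N -> (entry e i < p + 1 + i)%N.
  case: i => [|i] im; first by rewrite /= addn0 addn1.
  rewrite -[i]/(val (Ordinal im)) entry_ord; exact: (forallP ve (Ordinal im)).
(* The conventions s_0 = s_(m+1) = 1 may be replaced by p + 1 + i because the entries there are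
   zero; consecutive denominators then always differ by one. *)
have ratioE i : (i <= m.+1)%N -> Defs.ratio e i = (entry e i)%:R / (p + 1 + i)%:R.
  move=> im; rewrite /Defs.ratio /sext (_ : Defs.ext e i = entry e i) //.
  case: ifP => // /negbT; rewrite negb_and -leqNgt leqn0 -ltnNge => /orP[/eqP->|mi].
    by rewrite !mul0r.
  have -> : i = m.+1 by apply/eqP; rewrite eqn_leq im.
  by rewrite last0 !mul0r.
transitivity (\prod_(i < m.+1) step_weight (entry e i) (entry e i.+1)); last first.
  by rewrite big_ord_recr /= last0.
rewrite /col /asc -!prodr_const [X in X * _]big_mkcond [X in _ * X]big_mkcond.
rewrite -big_split; apply: eq_bigr => i _ /=; rewrite !inE.
rewrite (ratioE _ (ltnW (ltn_ord i))) (ratioE _ (ltn_ord i)) (addnS (p + 1)).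
rewrite !(ratio_cmp _ (entry_lt i (ltn_ord i))) /step_weight.
by case: ifP => [/andP[/eqP-> /eqP->]|_]; rewrite ?mulr1 ?mul1r.
Qed.

(** The case k = 1, where [s] is empty, is included because the real-rootedness claim covers it. *)
Lemma chow_hilbert n k j : (0 < k)%N -> (k <= n)%N ->
  exists d : nat, @isDimCH n (@urank n k) j d /\
    (Etilde k.-1 (fun i => n - k + 1 + i)%N)`_j = d%:Z.
Proof.
move=> k0 le_kn; exists (size [seq f <- @nested_seq n k | size (nested_sets f) == j]).
split.
  apply: dimCH => //; first by rewrite filter_uniq // uniq_nested_seq.
  by move=> f; rewrite mem_filter mem_nested_seq // andbC.
rewrite Etilde_transfer prednK // -nested_count.
suff -> : prefix_gf (n - k) k 0 = \sum_(f <- nested_seq n k) 'X^(size (nested_sets f)) by [].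
have [-> _] := prefix_gf_closed (n - k) k; rewrite nested_gf // /hilb subnK //.
case: k k0 le_kn => // k _ le_kn.
(* The full set alone gives [k+1] = x^k + [k], whose second part is the term c = 0 of [hilb];
   [chain_poly_rec] is 0 there, as the empty set has no positive multiplicity. *)
rewrite !big_ord_recl !bin0 !mulr1n subn0 mul1r addrA -qintS.
have V0 N : chain_poly_rec N 0 = 0 by rewrite (@chain_poly_rec_stable _ 0) //= qint0 mulr0 addr0.
rewrite V0 mulr0 add0r; congr (_ + _); apply: eq_bigr => i _.
rewrite mulrC; congr (_ * _ *+ _).
by apply: chain_poly_rec_stable => //; have := ltn_ord i; rewrite lift0; lia.
Qed.

Theorem theorem5p2 :
  (* H_{U_{k,n}}(x) = \tilde E^s_{k-1}(x), s = (n-k+2, ..., n) *)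
  (forall k n : nat, (2 <= k <= n)%N -> forall j : nat,
     exists d : nat, @isDimCH n (@urank n k) j d /\
       (Etilde k.-1 (fun i => n - k + 1 + i)%N)`_j = d%:Z)
  /\
  (* consequence, using Haglund--Zhang real-rootedness of all \tilde E^s_m *)
  ((forall (R : realType) (m : nat) (s : nat -> nat),
      (forall i, (1 <= i <= m)%N -> (0 < s i)%N) ->
      realrooted (map_poly (intmul (1 : R)) (Etilde m s))) ->
   forall (R : realType) (k n : nat), (1 <= k <= n)%N ->
     exists p : {poly R}, realrooted p /\
       forall j : nat, exists d : nat, @isDimCH n (@urank n k) j d /\ p`_j = d%:R).
Proof.
split=> [k n /andP[k2 le_kn] j|HZ R k n /andP[k1 le_kn]].
  by apply: chow_hilbert => //; apply: ltnW.
exists (map_poly (intmul (1 : R)) (Etilde k.-1 (fun i => n - k + 1 + i)%N)); split.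
  by apply: HZ => i _; rewrite addn_gt0 addn1.
move=> j; have [d [dimd cd]] := chow_hilbert j k1 le_kn.
by exists d; split=> //; rewrite coef_map_id0 ?mulr0z // cd -pmulrn.
Qed.
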